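(* Let $k$ be a field, $A$ a $k$-algebra, $\mathcal C$ an $A$-coring and $M$ a right $\mathcal C$-comodule that is finitely generated and projective as a right $A$-module. Set $S=\mathrm{End}^{-\mathcal C}(M)$. View $M^*\otimes_k M$ as a left $\mathcal C$-comodule via ${}^{M^*}\!\varrho\otimes_k M$. Then the following statements are equivalent: (1) $\mathcal C$ is a flat left $A$-module and the map $$\widetilde{\mathrm{can}}_M:M^*\otimes_k M\to\mathcal C,\qquad \xi\otimes m\mapsto\sum\xi(m_{(0)})m_{(1)},$$ is a split epimorphism of left $\mathcal C$-comodules. (2) $M$ is a principal right $\mathcal C$-comodule.
   Context: Algebras are associative and unital. An $A$-coring $\mathcal C$ is an $(A,A)$-bimodule with coassociative coproduct $\Delta_{\mathcal C}:\mathcal C\to\mathcal C\otimes_A\mathcal C$ and counit $\varepsilon_{\mathcal C}:\mathcal C\to A$ (bimodule maps). For a right $\mathcal C$-comodule $M$ the coaction is $\varrho^M(m)=\sum m_{(0)}\otimes m_{(1)}\in M\otimes_A\mathcal C$. $\mathrm{Hom}^{-\mathcal C}(M,N)$ denotes right $\mathcal C$-colinear maps, $\mathrm{End}^{-\mathcal C}(M)$ the endomorphism ring with product given by composition; $M$ is a left $S$-module and $\mathrm{Hom}^{-\mathcal C}(M,N)$ a right $S$-module via $fs=f\circ s$. $\mathcal C$ is a left and right $\mathcal C$-comodule via $\Delta_{\mathcal C}$. If $M_A$ is finitely generated projective with dual basis $\{e^i\in M,\xi^i\in M^*\}$, then $M^*=\mathrm{Hom}_{-A}(M,A)$ is a left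 $\mathcal C$-comodule with coaction ${}^{M^*}\!\varrho:M^*\to\mathcal C\otimes_A M^*$, $\xi\mapsto\sum_i\xi(e^i_{(0)})e^i_{(1)}\otimes\xi^i$. A right $\mathcal C$-comodule $M$ is a Galois comodule if it is finitely generated and projective as a right $A$-module and $\varphi_{\mathcal C}:\mathrm{Hom}^{-\mathcal C}(M,\mathcal C)\otimes_S M\to\mathcal C$, $f\otimes m\mapsto f(m)$, is an isomorphism of right $\mathcal C$-comodules. A Galois right $\mathcal C$-comodule $M$ is principal if it is projective as a left module over $S=\mathrm{End}^{-\mathcal C}(M)$. *)

(* Defs.v *)
From HB Require Import structures.
From mathcomp Require Import all_boot all_order all_algebra generic_quotient.
From mathcomp Require Import boolp functions.

Set Implicit Arguments.
Unset Strict Implicit.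
Unset Printing Implicit Defensive.

Import GRing.Theory.
Local Open Scope ring_scope.
Local Open Scope quotient_scope.

(* Right modules and bimodules are introduced as structures of their own: a
   bimodule seen through [lmodType A] and [lmodType B^c] would need two
   competing left scalings on one carrier. *)
HB.mixin Record Zmodule_isRModule (R : pzRingType) V of GRing.Zmodule V := {
  ract : V -> R -> V;
  ractA : forall v a b, ract (ract v a) b = ract v (a * b);
  ract1 : forall v, ract v 1 = v;
  ractDl : forall a, {morph ract^~ a : u v / u + v};
  ractDr : forall v, {morph ract v : a b / a + b}
}.

#[short(type="rmodType")]
HB.structure Definition RModule (R : pzRingType) :=
  {V of GRing.Zmodule V & Zmodule_isRModule R V}.

Notation "v <* a" := (ract v a) (at level 40, left associativity) : ring_scope.

HB.mixin Record LRModule_isBimodule (A B : pzRingType) V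
    of GRing.Lmodule A V & RModule B V := {
  bimodA : forall (a : A) (v : V) (b : B), a *: (v <* b) = (a *: v) <* b
}.

#[short(type="bimodType")]
HB.structure Definition Bimodule (A B : pzRingType) :=
  {V of GRing.Lmodule A V & RModule B V & LRModule_isBimodule A B V}.

(* An associative unital k-algebra is a ring with a ring morphism from k to its
   centre; unlike [algType], this does not exclude the zero algebra. *)
HB.mixin Record PzRing_isPzAlgebra (k : comPzRingType) A of GRing.PzRing A := {
  kscal : k -> A;
  kscalD : {morph kscal : l m / l + m};
  kscalM : {morph kscal : l m / l * m};
  kscal1 : kscal 1 = 1;
  kscalC : forall l a, kscal l * a = a * kscal l
}.

#[short(type="pzAlgType")]
HB.structure Definition PzAlgebra (k : comPzRingType) :=
  {A of GRing.PzRing A & PzRing_isPzAlgebra k A}.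

Section AlgTypePzAlgebra.
Variables (k : comPzRingType) (A : algType k).

Fact alg_scalD : {morph (fun l : k => l%:A : A) : l m / l + m}.
Proof. by move=> l m; rewrite /= scalerDl. Qed.
Fact alg_scalM : {morph (fun l : k => l%:A : A) : l m / l * m}.
Proof. by move=> l m; rewrite /= -scalerAl mul1r scalerA. Qed.
Fact alg_scalC (l : k) (a : A) : l%:A * a = a * l%:A.
Proof. by rewrite -scalerAl -scalerAr mul1r mulr1. Qed.

HB.instance Definition _ := PzRing_isPzAlgebra.Build k A
  alg_scalD alg_scalM (scale1r 1) alg_scalC.

End AlgTypePzAlgebra.

Definition rlinear (R : pzRingType) (M N : rmodType R) (f : M -> N) : Prop :=
  forall (a : R) (u v : M), f (u <* a + v) = f u <* a + f v.

Section RModuleTheory.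
Variables (R : pzRingType) (M N : rmodType R).
Implicit Types (u v : M) (a : R).

Lemma ract0l a : (0 : M) <* a = 0.
Proof. by apply: (addrI (0 <* a)); rewrite -ractDl !addr0. Qed.

Lemma ract0r v : v <* (0 : R) = 0.
Proof. by apply: (addrI (v <* (0 : R))); rewrite -ractDr !addr0. Qed.

Lemma ractNl a v : (- v) <* a = - (v <* a).
Proof. by apply: (addrI (v <* a)); rewrite -ractDl !subrr ract0l. Qed.

Lemma ract_sumr I (r : seq I) (F : I -> R) v :
  v <* (\sum_(i <- r) F i) = \sum_(i <- r) v <* F i.
Proof.
by elim/big_rec2: _ => [|i x y _ <-]; rewrite ?ract0r ?ractDr.
Qed.

Lemma ract_suml I (r : seq I) (F : I -> M) a :
  (\sum_(i <- r) F i) <* a = \sum_(i <- r) F i <* a.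
Proof.
by elim/big_rec2: _ => [|i x y _ <-]; rewrite ?ract0l ?ractDl.
Qed.

Variable f : M -> N.
Hypothesis fP : rlinear f.

Lemma rlinearD u v : f (u + v) = f u + f v.
Proof. by have := fP 1 u v; rewrite !ract1. Qed.

Lemma rlinear0 : f 0 = 0.
Proof. by apply: (addrI (f 0)); rewrite -rlinearD !addr0. Qed.

Lemma rlinearZ u a : f (u <* a) = f u <* a.
Proof. by have := fP a u 0; rewrite rlinear0 !addr0. Qed.

Lemma rlinear_sum I (r : seq I) (F : I -> M) :
  f (\sum_(i <- r) F i) = \sum_(i <- r) f (F i).
Proof.
by elim/big_rec2: _ => [|i x y _ <-]; rewrite ?rlinear0 ?rlinearD.
Qed.

End RModuleTheory.

Section TensorProduct.
Variables (R : pzRingType) (M : rmodType R) (N : lmodType R).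
Implicit Types (s t : seq (M * N)).

(* [M ⊗_R N] is the quotient of the commutative monoid of formal sums of pairs
   by the bilinearity and balancing relations; it is already a group, because
   the class of [(- m, n)] is opposite to that of [(m, n)]. *)
Inductive tcong : seq (M * N) -> seq (M * N) -> Prop :=
| tcong_refl s : tcong s s
| tcong_sym s t : tcong s t -> tcong t s
| tcong_trans s t u : tcong s t -> tcong t u -> tcong s u
| tcong_cat s s' t t' : tcong s s' -> tcong t t' -> tcong (s ++ t) (s' ++ t')
| tcong_comm s t : tcong (s ++ t) (t ++ s)
| tcong_zero n : tcong [:: (0, n)] [::]
| tcong_addl m m' n : tcong [:: (m + m', n)] [:: (m, n); (m', n)]
| tcong_addr m n n' : tcong [:: (m, n + n')] [:: (m, n); (m, n')]
| tcong_bal m r n : tcong [:: (m <* r, n)] [:: (m, r *: n)].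

Definition tcongb : rel (seq (M * N)) := fun s t => `[< tcong s t >].

Fact tcongb_equiv : equiv_class_of tcongb.
Proof.
split=> [s|s t|t s u]; rewrite /tcongb.
- exact/asboolP/tcong_refl.
- by apply/asboolP/asboolP; apply: tcong_sym.
- by move=> /asboolP h1 /asboolP h2; apply/asboolP; apply: tcong_trans h1 h2.
Qed.

Canonical tcong_equiv := EquivRelPack tcongb_equiv.

Definition tensor : Type := {eq_quot tcong_equiv}.
HB.instance Definition _ := Choice.on tensor.
HB.instance Definition _ := EqQuotient.on tensor.

Definition tclass s : tensor := \pi_tensor s.

Definition tpure (m : M) (n : N) : tensor := tclass [:: (m, n)].

Lemma tclassP s t : tclass s = tclass t <-> tcong s t.
Proof.
split=> [/eqP|h]; first by rewrite /tclass eqmodE => /asboolP.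
by apply/eqP; rewrite /tclass eqmodE; apply/asboolP.
Qed.

Lemma tclassK (x : tensor) : tclass (repr x) = x.
Proof. exact: reprK. Qed.

Lemma repr_tclass s : tcong (repr (tclass s)) s.
Proof. by apply/tclassP; rewrite tclassK. Qed.

Definition tadd (x y : tensor) : tensor := tclass (repr x ++ repr y).
Definition topp (x : tensor) : tensor :=
  tclass [seq (- p.1, p.2) | p <- repr x].

Lemma tadd_class s t : tadd (tclass s) (tclass t) = tclass (s ++ t).
Proof. by apply/tclassP; apply: tcong_cat; apply: repr_tclass. Qed.

Fact taddA : associative tadd.
Proof.
move=> x y z; rewrite -(tclassK x) -(tclassK y) -(tclassK z).
by rewrite !tadd_class catA.
Qed.

Fact taddC : commutative tadd.
Proof.
move=> x y; rewrite -(tclassK x) -(tclassK y) !tadd_class.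
by apply/tclassP; apply: tcong_comm.
Qed.

Fact tadd0 : left_id (tclass [::]) tadd.
Proof. by move=> x; rewrite -(tclassK x) tadd_class. Qed.

Fact taddN : left_inverse (tclass [::]) topp tadd.
Proof.
move=> x; rewrite -[in X in tadd _ X](tclassK x) tadd_class.
elim: (repr x) => [//|[m n] s IH].
have -> : [seq (- p.1, p.2) | p <- (m, n) :: s] ++ (m, n) :: s =
  [:: (- m, n)] ++ ([seq (- p.1, p.2) | p <- s] ++ [:: (m, n)]) ++ s.
  by rewrite /= -catA.
rewrite -tadd_class -(tadd_class (_ ++ _)) -(tadd_class [seq _ | _ <- _]).
rewrite (taddC (tclass [seq _ | _ <- _])) -taddA tadd_class IH.
rewrite (taddC (tclass [:: (m, n)])) tadd0 tadd_class; apply/tclassP.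
by apply: tcong_trans (tcong_zero n); rewrite -(addNr m); apply/tcong_sym/tcong_addl.
Qed.

HB.instance Definition _ :=
  GRing.isZmodule.Build tensor taddA taddC tadd0 taddN.

Lemma tclass_cat s t : tclass (s ++ t) = tclass s + tclass t.
Proof. by rewrite -tadd_class. Qed.

Lemma tclassE s : tclass s = \sum_(p <- s) tpure p.1 p.2.
Proof.
elim: s => [|[m n] s IH]; first by rewrite big_nil.
by rewrite big_cons -IH -tclass_cat.
Qed.

Lemma tensorE (x : tensor) : x = \sum_(p <- repr x) tpure p.1 p.2.
Proof. by rewrite -tclassE tclassK. Qed.

Lemma tpureDl m m' n : tpure (m + m') n = tpure m n + tpure m' n.
Proof. by rewrite -tclass_cat; apply/tclassP; apply: tcong_addl. Qed.

Lemma tpureDr m n n' : tpure m (n + n') = tpure m n + tpure m n'.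
Proof. by rewrite -tclass_cat; apply/tclassP; apply: tcong_addr. Qed.

Lemma tpure_bal m r n : tpure (m <* r) n = tpure m (r *: n).
Proof. by apply/tclassP; apply: tcong_bal. Qed.

Lemma tpure0l n : tpure 0 n = 0.
Proof. by apply: (addrI (tpure 0 n)); rewrite -tpureDl !addr0. Qed.

Lemma tpure0r m : tpure m 0 = 0.
Proof. by apply: (addrI (tpure m 0)); rewrite -tpureDr !addr0. Qed.

Lemma tpure_suml I (r : seq I) (F : I -> M) n :
  tpure (\sum_(i <- r) F i) n = \sum_(i <- r) tpure (F i) n.
Proof.
by elim/big_rec2: _ => [|i x y _ <-]; rewrite ?tpure0l ?tpureDl.
Qed.

Lemma tpure_sumr I (r : seq I) m (F : I -> N) :
  tpure m (\sum_(i <- r) F i) = \sum_(i <- r) tpure m (F i).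
Proof.
by elim/big_rec2: _ => [|i x y _ <-]; rewrite ?tpure0r ?tpureDr.
Qed.

Lemma tensor_ind (P : tensor -> Prop) :
    (forall m n, P (tpure m n)) -> (forall x y, P x -> P y -> P (x + y)) ->
  forall x, P x.
Proof.
move=> Pp PD x; rewrite (tensorE x); elim/big_ind: _ => //.
by rewrite -(tpure0l 0).
Qed.

Section Lift.
Variable Z : zmodType.

Definition balanced (f : M -> N -> Z) : Prop :=
  [/\ forall m m' n, f (m + m') n = f m n + f m' n,
      forall m n n', f m (n + n') = f m n + f m n'
    & forall m r n, f (m <* r) n = f m (r *: n)].

(* The additive map [m ⊗ n |-> f m n]; it only makes sense for balanced [f],
   see [tlift_pure]. *)
Definition tlift (f : M -> N -> Z) (x : tensor) : Z :=
  \sum_(p <- repr x) f p.1 p.2.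

Variable f : M -> N -> Z.
Hypothesis fP : balanced f.

Lemma tlift_class s : tlift f (tclass s) = \sum_(p <- s) f p.1 p.2.
Proof.
case: fP => fDl fDr fb.
have key s1 s2 : tcong s1 s2 ->
    \sum_(p <- s1) f p.1 p.2 = \sum_(p <- s2) f p.1 p.2.
  elim=> {s1 s2} //.
  - by move=> s1 s2 s3 _ -> _ ->.
  - by move=> s1 s1' s2 s2' _ h1 _ h2; rewrite !big_cat h1 h2.
  - by move=> s1 s2; rewrite !big_cat /= addrC.
  - move=> n; rewrite big_seq1 big_nil /=.
    by apply: (addrI (f 0 n)); rewrite -fDl !addr0.
  - by move=> m m' n; rewrite !big_cons big_nil /= addr0 fDl addr0.
  - by move=> m n n'; rewrite !big_cons big_nil /= addr0 fDr addr0.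
  - by move=> m r n; rewrite !big_seq1 /= fb.
exact/key/repr_tclass.
Qed.

Lemma tlift_pure m n : tlift f (tpure m n) = f m n.
Proof. by rewrite tlift_class big_seq1. Qed.

Lemma tliftD x y : tlift f (x + y) = tlift f x + tlift f y.
Proof.
rewrite -(tclassK x) -(tclassK y) -tclass_cat !tlift_class.
by rewrite big_cat.
Qed.

Lemma tlift0 : tlift f 0 = 0.
Proof. by apply: (addrI (tlift f 0)); rewrite -tliftD !addr0. Qed.

Lemma tlift_sum I (r : seq I) (F : I -> tensor) :
  tlift f (\sum_(i <- r) F i) = \sum_(i <- r) tlift f (F i).
Proof.
by elim/big_rec2: _ => [|i x y _ <-]; rewrite ?tlift0 ?tliftD.
Qed.

End Lift.

Lemma eq_tlift (Z : zmodType) (f g : M -> N -> Z) :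
  (forall m n, f m n = g m n) -> tlift f =1 tlift g.
Proof. by move=> fg x; apply: eq_bigr => p _; apply: fg. Qed.

Lemma eq_tensor (Z : zmodType) (f g : tensor -> Z) :
    {morph f : x y / x + y} -> {morph g : x y / x + y} ->
    (forall m n, f (tpure m n) = g (tpure m n)) ->
  f =1 g.
Proof.
by move=> fD gD fg; apply: tensor_ind => // x y; rewrite fD gD => -> ->.
Qed.

End TensorProduct.

Notation "m ⊗ n" := (tpure m n) (at level 40, left associativity) : ring_scope.

Section TensorMap.
Variables (R : pzRingType) (M M' : rmodType R) (N N' : lmodType R).
Implicit Types (f : M -> M') (g : N -> N').

Definition tmap (f : M -> M') (g : N -> N') : tensor M N -> tensor M' N' :=
  tlift (fun m n => f m ⊗ g n).

Lemma tmap_balanced f g :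
  rlinear f -> linear g -> balanced (fun m n => f m ⊗ g n).
Proof.
move=> fP gP; have gD n n' : g (n + n') = g n + g n'.
  by have := gP 1 n n'; rewrite !scale1r.
have g0 : g 0 = 0 by apply: (addrI (g 0)); rewrite -gD !addr0.
split=> [m m' n|m n n'|m r n].
- by rewrite (rlinearD fP) tpureDl.
- by rewrite gD tpureDr.
- by rewrite (rlinearZ fP) tpure_bal; have := gP r n 0; rewrite g0 !addr0 => ->.
Qed.

Lemma tmap_pure f g m n :
  rlinear f -> linear g -> tmap f g (m ⊗ n) = f m ⊗ g n.
Proof. by move=> fP gP; rewrite /tmap tlift_pure//; apply: tmap_balanced. Qed.

Lemma tmapD f g : rlinear f -> linear g -> {morph tmap f g : x y / x + y}.
Proof. by move=> fP gP x y; apply: tliftD; apply: tmap_balanced. Qed.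

End TensorMap.

Section TensorLeft.
Variables (B R : pzRingType) (M : bimodType B R) (N : lmodType R).

Definition tlscale (b : B) : tensor M N -> tensor M N :=
  tmap (fun m => b *: m) idfun.

Fact tlscale_rlin b : rlinear (fun m : M => b *: m).
Proof. by move=> a u v; rewrite scalerDr bimodA. Qed.

Lemma tlscale_pure b m n : tlscale b (m ⊗ n) = (b *: m) ⊗ n.
Proof. by rewrite /tlscale tmap_pure//; apply: tlscale_rlin. Qed.

Lemma tlscaleDr b : {morph tlscale b : x y / x + y}.
Proof. by apply: tmapD => //; apply: tlscale_rlin. Qed.

Fact tlscaleA a b x : tlscale a (tlscale b x) = tlscale (a * b) x.
Proof.
elim/tensor_ind: x => [m n|x y IHx IHy]; last by rewrite !tlscaleDr IHx IHy.
by rewrite !tlscale_pure scalerA.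
Qed.

Fact tlscale1 : left_id 1 tlscale.
Proof.
elim/tensor_ind=> [m n|x y IHx IHy]; last by rewrite tlscaleDr IHx IHy.
by rewrite tlscale_pure scale1r.
Qed.

Fact tlscaleDl x : {morph tlscale^~ x : a b / a + b}.
Proof.
move=> a b /=; elim/tensor_ind: x => [m n|x y IHx IHy].
  by rewrite !tlscale_pure scalerDl tpureDl.
by rewrite !tlscaleDr IHx IHy addrACA.
Qed.

HB.instance Definition _ := GRing.Zmodule_isLmodule.Build B (tensor M N)
  tlscaleA tlscale1 tlscaleDr tlscaleDl.

Lemma tscale_pure (b : B) (m : M) (n : N) : b *: (m ⊗ n) = (b *: m) ⊗ n.
Proof. exact: tlscale_pure. Qed.

End TensorLeft.

Section TensorRight.
Variables (R B : pzRingType) (M : rmodType R) (N : bimodType R B).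

Definition tract (x : tensor M N) (b : B) : tensor M N :=
  tmap idfun (fun n => n <* b) x.

Fact tract_lin b : linear (fun n : N => n <* b).
Proof. by move=> a u v; rewrite ractDl bimodA. Qed.

Lemma tract_pure0 m n b : tract (m ⊗ n) b = m ⊗ (n <* b).
Proof. by rewrite /tract tmap_pure//; apply: tract_lin. Qed.

Fact tractDl b : {morph tract^~ b : x y / x + y}.
Proof. by apply: tmapD => //; apply: tract_lin. Qed.

Fact tractA x a b : tract (tract x a) b = tract x (a * b).
Proof.
elim/tensor_ind: x => [m n|x y IHx IHy].
  by rewrite !tract_pure0 ractA.
by rewrite !(tractDl _ x y) (tractDl _ _ (tract y a)) IHx IHy.
Qed.

Fact tract1 x : tract x 1 = x.
Proof.
elim/tensor_ind: x => [m n|x y IHx IHy]; last by rewrite tractDl IHx IHy.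
by rewrite tract_pure0 ract1.
Qed.

Fact tractDr x : {morph tract x : a b / a + b}.
Proof.
move=> a b; elim/tensor_ind: x => [m n|x y IHx IHy].
  by rewrite !tract_pure0 ractDr tpureDr.
by rewrite !(tractDl _ x y) IHx IHy addrACA.
Qed.

HB.instance Definition _ :=
  Zmodule_isRModule.Build B (tensor M N) tractA tract1 tractDl tractDr.

Lemma tract_pure (m : M) (n : N) (b : B) : (m ⊗ n) <* b = m ⊗ (n <* b).
Proof. exact: tract_pure0. Qed.

End TensorRight.

Section TensorBimodule.
Variables (B R D : pzRingType) (M : bimodType B R) (N : bimodType R D).

Fact tensor_bimodA (b : B) (x : tensor M N) (d : D) :
  b *: (x <* d) = (b *: x) <* d.
Proof.
elim/tensor_ind: x => [m n|x y IHx IHy].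
  by rewrite tract_pure !tscale_pure tract_pure.
by rewrite ractDl !scalerDr ractDl IHx IHy.
Qed.

HB.instance Definition _ :=
  LRModule_isBimodule.Build B D (tensor M N) tensor_bimodA.

End TensorBimodule.

Section Associator.
Variables (R T : pzRingType).
Variables (M : rmodType R) (N : bimodType R T) (P : lmodType T).

Definition tassoc : tensor (tensor M N) P -> tensor M (tensor N P) :=
  tlift (fun x p => tlift (fun m n => m ⊗ (n ⊗ p)) x).

Lemma tassoc_balanced1 (p : P) :
  balanced (fun (m : M) (n : N) => m ⊗ (n ⊗ p)).
Proof.
split=> [m m' n|m n n'|m r n].
- by rewrite tpureDl.
- by rewrite tpureDl tpureDr.
- by rewrite tpure_bal tscale_pure.
Qed.

Lemma tassoc_balanced :
  balanced (fun (x : tensor M N) (p : P) => tlift (fun m n => m ⊗ (n ⊗ p)) x).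
Proof.
have hb := tassoc_balanced1.
split=> [x y p|x p p'|x t p].
- exact: tliftD.
- elim/tensor_ind: x => [m n|x y IHx IHy].
    by rewrite !tlift_pure// !tpureDr.
  by rewrite !(tliftD (hb _)) IHx IHy addrACA.
- elim/tensor_ind: x => [m n|x y IHx IHy].
    by rewrite tract_pure !tlift_pure// tpure_bal.
  by rewrite ractDl !(tliftD (hb _)) IHx IHy.
Qed.

Lemma tassoc_pure m n p : tassoc ((m ⊗ n) ⊗ p) = m ⊗ (n ⊗ p).
Proof.
rewrite /tassoc tlift_pure; last exact: tassoc_balanced.
by rewrite tlift_pure//; apply: tassoc_balanced1.
Qed.

Lemma tassocD : {morph tassoc : x y / x + y}.
Proof. by move=> x y; apply: tliftD; apply: tassoc_balanced. Qed.

End Associator.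

Definition flat_left (R : pzRingType) (N : lmodType R) : Prop :=
  forall (X Y : rmodType R) (f : X -> Y), rlinear f -> injective f ->
    injective (tmap f (@idfun N)).

Definition projective_left (R : pzRingType) (P : lmodType R) : Prop :=
  forall (X Y : lmodType R) (p : X -> Y) (f : P -> Y),
    linear p -> linear f -> (forall y, exists x, p x = y) ->
    exists g : P -> X, linear g /\ forall u, p (g u) = f u.

Definition projective_right (R : pzRingType) (P : rmodType R) : Prop :=
  forall (X Y : rmodType R) (p : X -> Y) (f : P -> Y),
    rlinear p -> rlinear f -> (forall y, exists x, p x = y) ->
    exists g : P -> X, rlinear g /\ forall u, p (g u) = f u.

Definition fin_gen_right (R : pzRingType) (M : rmodType R) : Prop :=
  exists (n : nat) (g : 'I_n -> M),
    forall m, exists a : 'I_n -> R, m = \sum_i g i <* a i.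

Section Dual.
Variables (A : pzRingType) (M : rmodType A).

Definition rform (f : M -> A) : Prop :=
  forall (a : A) (u v : M), f (u <* a + v) = f u * a + f v.

Definition rform_pred : {pred M -> A} := fun f => `[< rform f >].

Fact rform_zmod_closed : zmod_closed rform_pred.
Proof.
split=> [|f g /asboolP fP /asboolP gP]; apply/asboolP => a u v.
  by change (0 = 0 * a + 0 :> A); rewrite mul0r addr0.
change (f (u <* a + v) - g (u <* a + v) =
        (f u - g u) * a + (f v - g v) :> A).
by rewrite fP gP mulrBl opprD addrACA.
Qed.
HB.instance Definition _ :=
  GRing.isZmodClosed.Build (M -> A) rform_pred rform_zmod_closed.

(* M^* = Hom_{-A}(M, A) *)
Record dual := Dual { dual_fun :> M -> A; _ : dual_fun \in rform_pred }.

HB.instance Definition _ := [isSub for dual_fun].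
HB.instance Definition _ := [Choice of dual by <:].
HB.instance Definition _ := [SubChoice_isSubZmodule of dual by <:].

Lemma dualP (f : dual) : rform f.
Proof. by case: f => f fP; apply/asboolP. Qed.

Lemma dual_ext (f g : dual) : f =1 g -> f = g.
Proof. by move=> fg; apply/val_inj/funext/fg. Qed.

Lemma dualDE (f g : dual) m : (f + g) m = f m + g m.
Proof. by []. Qed.

Lemma dualD (f : dual) u v : f (u + v) = f u + f v.
Proof. by have := dualP f 1 u v; rewrite ract1 mulr1. Qed.

Lemma dual0 (f : dual) : f 0 = 0.
Proof. by apply: (addrI (f 0)); rewrite -dualD !addr0. Qed.

Lemma dualZ (f : dual) u a : f (u <* a) = f u * a.
Proof. by have := dualP f a u 0; rewrite dual0 !addr0. Qed.

Lemma dual_sum (f : dual) I (r : seq I) (F : I -> M) :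
  f (\sum_(i <- r) F i) = \sum_(i <- r) f (F i).
Proof. by elim/big_rec2: _ => [|i x y _ <-]; rewrite ?dual0 ?dualD. Qed.

Fact dual_scale_subproof (a : A) (f : dual) : (fun m => a * f m) \in rform_pred.
Proof. by apply/asboolP => b u v; rewrite dualP mulrDr mulrA. Qed.
Definition dual_scale a f := Dual (dual_scale_subproof a f).

Fact dual_scaleA a b f : dual_scale a (dual_scale b f) = dual_scale (a * b) f.
Proof. by apply: dual_ext => m /=; rewrite mulrA. Qed.
Fact dual_scale1 : left_id 1 dual_scale.
Proof. by move=> f; apply: dual_ext => m /=; rewrite mul1r. Qed.
Fact dual_scaleDr : right_distributive dual_scale +%R.
Proof. by move=> a f g; apply: dual_ext => m /=; rewrite mulrDr. Qed.
Fact dual_scaleDl f : {morph dual_scale^~ f : a b / a + b}.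
Proof. by move=> a b; apply: dual_ext => m /=; rewrite mulrDl. Qed.

HB.instance Definition _ := GRing.Zmodule_isLmodule.Build A dual
  dual_scaleA dual_scale1 dual_scaleDr dual_scaleDl.

Lemma dual_scaleE (a : A) (f : dual) m : (a *: f) m = a * f m.
Proof. by []. Qed.

Record dual_basis := DualBasis {
  db_size : nat;
  db_elt : 'I_db_size -> M;
  db_form : 'I_db_size -> dual;
  db_eq : forall m, m = \sum_i db_elt i <* db_form i m
}.

End Dual.

(* The k-vector space structures on a right A-module [M] and on M^* are the ones
   induced by k -> A; as its image is central, M^* is an (A, k)-bimodule. *)
Section DualScalars.
Variables (k : comPzRingType) (A : pzAlgType k) (M : rmodType A).

Definition dual_kact (f : dual M) (l : k) : dual M := (kscal l : A) *: f.

Fact dual_kactA f a b : dual_kact (dual_kact f a) b = dual_kact f (a * b).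
Proof. by rewrite /dual_kact scalerA -kscalM mulrC. Qed.
Fact dual_kact1 f : dual_kact f 1 = f.
Proof. by rewrite /dual_kact kscal1 scale1r. Qed.
Fact dual_kactDl a : {morph dual_kact^~ a : f g / f + g}.
Proof. by move=> f g; rewrite /dual_kact scalerDr. Qed.
Fact dual_kactDr f : {morph dual_kact f : a b / a + b}.
Proof. by move=> a b; rewrite /dual_kact kscalD scalerDl. Qed.

HB.instance Definition _ := Zmodule_isRModule.Build k (dual M)
  dual_kactA dual_kact1 dual_kactDl dual_kactDr.

Lemma dual_kactE (f : dual M) (l : k) : f <* l = (kscal l : A) *: f.
Proof. by []. Qed.

Fact dual_bimodA (a : A) (f : dual M) (l : k) : a *: (f <* l) = (a *: f) <* l.
Proof. by rewrite !dual_kactE !scalerA kscalC. Qed.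

HB.instance Definition _ := LRModule_isBimodule.Build A k (dual M) dual_bimodA.

End DualScalars.

Section ScalarRestriction.
Variables (k : comPzRingType) (A : pzAlgType k) (M : rmodType A).

Definition kspace : Type := M.
HB.instance Definition _ := GRing.Zmodule.on kspace.

Definition kspace_scale (l : k) (m : kspace) : kspace := (m : M) <* (kscal l : A).

Fact kspace_scaleA a b m :
  kspace_scale a (kspace_scale b m) = kspace_scale (a * b) m.
Proof. by rewrite /kspace_scale ractA -kscalM mulrC. Qed.
Fact kspace_scale1 : left_id 1 kspace_scale.
Proof. by move=> m; rewrite /kspace_scale kscal1 ract1. Qed.
Fact kspace_scaleDr : right_distributive kspace_scale +%R.
Proof. by move=> l m n; rewrite /kspace_scale ractDl. Qed.
Fact kspace_scaleDl m : {morph kspace_scale^~ m : a b / a + b}.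
Proof. by move=> a b; rewrite /kspace_scale kscalD ractDr. Qed.

HB.instance Definition _ := GRing.Zmodule_isLmodule.Build k kspace
  kspace_scaleA kspace_scale1 kspace_scaleDr kspace_scaleDl.

Lemma kspace_scaleE (l : k) (m : kspace) : l *: m = (m : M) <* (kscal l : A).
Proof. by []. Qed.

End ScalarRestriction.

Section TensorMapTheory.

Lemma linear_add (R : pzRingType) (M N : lmodType R) (f : M -> N) :
  linear f -> {morph f : x y / x + y}.
Proof. by move=> fP x y; have := fP 1 x y; rewrite !scale1r. Qed.

Lemma linear_zero (R : pzRingType) (M N : lmodType R) (f : M -> N) :
  linear f -> f 0 = 0.
Proof.
by move=> fP; apply: (addrI (f 0)); rewrite -(linear_add fP) !addr0.
Qed.

Lemma linear_scale (R : pzRingType) (M N : lmodType R) (f : M -> N) :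
  linear f -> forall a x, f (a *: x) = a *: f x.
Proof.
by move=> fP a x; have := fP a x 0; rewrite (linear_zero fP) !addr0.
Qed.

Lemma linear_big (R : pzRingType) (M N : lmodType R) (f : M -> N) :
  linear f -> forall I (r : seq I) (F : I -> M),
  f (\sum_(i <- r) F i) = \sum_(i <- r) f (F i).
Proof.
move=> fP I r F; elim/big_rec2: _ => [|i x y _ <-]; first exact: linear_zero.
exact: linear_add.
Qed.

Lemma tmap_comp (R : pzRingType) (M M' M'' : rmodType R) (N N' N'' : lmodType R)
    (f' : M' -> M'') (f : M -> M') (g' : N' -> N'') (g : N -> N') x :
    rlinear f' -> rlinear f -> linear g' -> linear g ->
  tmap f' g' (tmap f g x) = tmap (f' \o f) (g' \o g) x.
Proof.
move=> f'P fP g'P gP.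
have cf : rlinear (f' \o f) by move=> a u v /=; rewrite fP f'P.
have cg : linear (g' \o g) by move=> a u v /=; rewrite gP g'P.
elim/tensor_ind: x => [m n|x y IHx IHy]; first by rewrite !tmap_pure.
by rewrite (tmapD fP gP) (tmapD f'P g'P) (tmapD cf cg) IHx IHy.
Qed.

Lemma tmap_rlinear (R B : pzRingType) (M M' : rmodType R)
    (N N' : bimodType R B) (f : M -> M') (g : N -> N') :
  rlinear f -> linear g -> rlinear g -> rlinear (tmap f g).
Proof.
move=> fP gP gP' a x y; rewrite (tmapD fP gP); congr (_ + _).
elim/tensor_ind: x => [m n|x z IHx IHz].
  by rewrite tract_pure !tmap_pure// tract_pure (rlinearZ gP').
by rewrite ractDl !(tmapD fP gP) ractDl IHx IHz.
Qed.

Lemma tmap_linear (B R : pzRingType) (M M' : bimodType B R)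
    (N N' : lmodType R) (f : M -> M') (g : N -> N') :
  rlinear f -> linear f -> linear g -> linear (tmap f g).
Proof.
move=> fP fP' gP a x y; rewrite (tmapD fP gP); congr (_ + _).
elim/tensor_ind: x => [m n|x z IHx IHz].
  by rewrite tscale_pure !tmap_pure// tscale_pure (linear_scale fP').
by rewrite scalerDr !(tmapD fP gP) scalerDr IHx IHz.
Qed.

Lemma tassoc_tmap (R T : pzRingType) (M M' : rmodType R) (N N' : bimodType R T)
    (P P' : lmodType T) (f : M -> M') (g : N -> N') (h : P -> P') x :
    rlinear f -> linear g -> rlinear g -> linear h ->
  tassoc (tmap (tmap f g) h x) = tmap f (tmap g h) (tassoc x).
Proof.
move=> fP gP gP' hP.
have fgP : rlinear (tmap f g) by apply: tmap_rlinear.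
have ghP : linear (tmap g h) by apply: tmap_linear.
elim/tensor_ind: x => [x p|x y IHx IHy]; last first.
  by rewrite (tmapD fgP hP) !tassocD (tmapD fP ghP) IHx IHy.
elim/tensor_ind: x => [m n|x y IHx IHy]; last first.
  by rewrite tpureDl (tmapD fgP hP) !tassocD (tmapD fP ghP) IHx IHy.
by rewrite tassoc_pure !tmap_pure// tassoc_pure.
Qed.

Lemma tassoc_linear (B R T : pzRingType) (M : bimodType B R)
    (N : bimodType R T) (P : lmodType T) : linear (@tassoc R T M N P).
Proof.
move=> a x y; rewrite tassocD; congr (_ + _).
elim/tensor_ind: x => [x p|x z IHx IHz]; last first.
  by rewrite scalerDr !tassocD scalerDr IHx IHz.
elim/tensor_ind: x => [m n|x z IHx IHz]; last first.
  by rewrite tpureDl scalerDr !tassocD scalerDr IHx IHz.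
by rewrite !tscale_pure !tassoc_pure tscale_pure.
Qed.

Lemma eq_tmap (R : pzRingType) (M M' : rmodType R) (N N' : lmodType R)
    (f f' : M -> M') (g g' : N -> N') :
  f =1 f' -> g =1 g' -> tmap f g =1 tmap f' g'.
Proof. by move=> ff' gg'; apply: eq_tlift => m n; rewrite ff' gg'. Qed.

Lemma tmap_id (R : pzRingType) (M : rmodType R) (N : lmodType R) x :
  tmap (@idfun M) (@idfun N) x = x.
Proof.
elim/tensor_ind: x => [m n|x y IHx IHy]; first by rewrite tmap_pure.
by rewrite tmapD// IHx IHy.
Qed.

End TensorMapTheory.

(* As usual for bimodules over a k-algebra, k acts centrally on a coring. *)
Record coring (k : comPzRingType) (A : pzAlgType k) := Coring {
  coring_bimod :> bimodType A A;
  cdelta : coring_bimod -> tensor coring_bimod coring_bimod;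
  ceps : coring_bimod -> A;
  coring_kcentral : forall (l : k) (c : coring_bimod),
    (kscal l : A) *: c = c <* (kscal l : A);
  cdelta_linear : linear cdelta;
  cdelta_rlinear : rlinear cdelta;
  ceps_linear : forall a c d, ceps (a *: c + d) = a * ceps c + ceps d;
  ceps_rlinear : forall a c d, ceps (c <* a + d) = ceps c * a + ceps d;
  cdelta_coassoc : forall c,
    tassoc (tmap cdelta idfun (cdelta c)) = tmap idfun cdelta (cdelta c);
  ceps_counitl : forall c, tlift (fun c1 c2 => ceps c1 *: c2) (cdelta c) = c;
  ceps_counitr : forall c, tlift (fun c1 c2 => c1 <* ceps c2) (cdelta c) = c
}.

Section Comodules.
Variables (k : comPzRingType) (A : pzAlgType k) (C : coring A).

Record rcomodule := RComodule {
  rcomod_rmod :> rmodType A;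
  rcoact : rcomod_rmod -> tensor rcomod_rmod C;
  rcoact_rlinear : rlinear rcoact;
  rcoact_coassoc : forall m,
    tassoc (tmap rcoact idfun (rcoact m)) = tmap idfun (@cdelta k A C) (rcoact m);
  rcoact_counit : forall m, tlift (fun m0 m1 => m0 <* ceps m1) (rcoact m) = m
}.

Record lcomodule := LComodule {
  lcomod_lmod :> lmodType A;
  lcoact : lcomod_lmod -> tensor C lcomod_lmod;
  lcoact_linear : linear lcoact;
  lcoact_coassoc : forall m,
    tassoc (tmap (@cdelta k A C) idfun (lcoact m)) = tmap idfun lcoact (lcoact m);
  lcoact_counit : forall m, tlift (fun m1 m0 => ceps m1 *: m0) (lcoact m) = m
}.

Definition coring_rcomod : rcomodule :=
  RComodule (@cdelta_rlinear k A C) (@cdelta_coassoc k A C)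
    (@ceps_counitr k A C).

Definition coring_lcomod : lcomodule :=
  LComodule (@cdelta_linear k A C) (@cdelta_coassoc k A C)
    (@ceps_counitl k A C).

Definition rcolinear (M N : rcomodule) (f : M -> N) : Prop :=
  rlinear f /\ forall m, rcoact (f m) = tmap f idfun (rcoact m).

Definition lcolinear (M N : lcomodule) (f : M -> N) : Prop :=
  linear f /\ forall m, lcoact (f m) = tmap idfun f (lcoact m).

Definition rcomod_iso (M N : rcomodule) (f : M -> N) : Prop :=
  rcolinear f /\
  exists g : N -> M, [/\ rcolinear g, cancel f g & cancel g f].

Definition lcomod_split_epi (M N : lcomodule) (f : M -> N) : Prop :=
  lcolinear f /\
  exists s : N -> M, lcolinear s /\ cancel s f.

Section CoHom.
Variables M N : rcomodule.

Definition cohom_pred : {pred M -> N} := fun f => `[< rcolinear f >].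

Fact cohom_zmod_closed : zmod_closed cohom_pred.
Proof.
split=> [|f g /asboolP[fl fP] /asboolP[gl gP]]; apply/asboolP.
  have l0 : rlinear (0 : M -> N).
    by move=> a u v; change (0 = 0 <* a + 0 :> N); rewrite ract0l addr0.
  split=> // m; change (rcoact (0 : N) = tmap (0 : M -> N) idfun (rcoact m)).
  rewrite (rlinear0 (@rcoact_rlinear N)).
  elim/tensor_ind: (rcoact m) => [x c|x y IHx IHy].
    by rewrite tmap_pure// -[RHS]/(0 ⊗ c) tpure0l.
  by rewrite tmapD// -IHx -IHy addr0.
have lfg : rlinear (f - g : M -> N).
  move=> a u v; rewrite -[LHS]/(f (u <* a + v) - g (u <* a + v)).
  by rewrite fl gl opprD addrACA -ractNl -ractDl.
split=> // m; rewrite -[LHS]/(rcoact (f m - g m)).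
have rD := rlinearD (@rcoact_rlinear N).
have -> : rcoact (f m - g m) = rcoact (f m) - rcoact (g m).
  by apply: (addIr (rcoact (g m))); rewrite -rD !subrK.
rewrite fP gP; elim/tensor_ind: (rcoact m) => [x c|x y IHx IHy].
  rewrite !tmap_pure// -[X in _ = X ⊗ _]/(f x - g x).
  by apply: (addIr (g x ⊗ c)); rewrite -tpureDl !subrK.
by rewrite !tmapD// -IHx -IHy opprD addrACA.
Qed.
HB.instance Definition _ :=
  GRing.isZmodClosed.Build (M -> N) cohom_pred cohom_zmod_closed.

(* Hom^{-C}(M, N) *)
Record cohom := CoHom { cohom_fun :> M -> N; _ : cohom_fun \in cohom_pred }.

HB.instance Definition _ := [isSub for cohom_fun].
HB.instance Definition _ := [Choice of cohom by <:].
HB.instance Definition _ := [SubChoice_isSubZmodule of cohom by <:].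

Lemma cohomP (f : cohom) : rcolinear f.
Proof. by case: f => f fP; apply/asboolP. Qed.

Lemma cohom_rlinear (f : cohom) : rlinear f.
Proof. by case: (cohomP f). Qed.

Lemma cohom_ext (f g : cohom) : f =1 g -> f = g.
Proof. by move=> fg; apply/val_inj/funext/fg. Qed.

Lemma cohomDE (f g : cohom) m : (f + g) m = f m + g m.
Proof. by []. Qed.

End CoHom.

Section CoComp.
Variables M N P : rcomodule.

Fact cocomp_subproof (f : cohom N P) (g : cohom M N) :
  (fun m => f (g m)) \in @cohom_pred M P.
Proof.
apply/asboolP; have [fl fP] := cohomP f; have [gl gP] := cohomP g.
by split=> [a u v|m]; rewrite ?gl ?fl// fP gP tmap_comp.
Qed.
Definition cocomp f g : cohom M P := CoHom (cocomp_subproof f g).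

End CoComp.

Section CoEnd.
Variable M : rcomodule.

(* S = End^{-C}(M) *)
Definition coend : Type := cohom M M.
HB.instance Definition _ := GRing.Zmodule.on coend.

Fact coid_subproof : idfun \in @cohom_pred M M.
Proof. by apply/asboolP; split=> // m; rewrite tmap_id. Qed.
Definition coid : coend := CoHom coid_subproof.

Definition comul (f g : coend) : coend := cocomp f g.

Fact comulA : associative comul.
Proof. by move=> f g h; apply: cohom_ext. Qed.
Fact comul1l : left_id coid comul.
Proof. by move=> f; apply: cohom_ext. Qed.
Fact comul1r : right_id coid comul.
Proof. by move=> f; apply: cohom_ext. Qed.
Fact comulDl : left_distributive comul +%R.
Proof. by move=> f g h; apply: cohom_ext. Qed.
Fact comulDr : right_distributive comul +%R.
Proof.
by move=> f g h; apply: cohom_ext => m; apply: (rlinearD (cohom_rlinear f)).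
Qed.

HB.instance Definition _ := GRing.Zmodule_isPzRing.Build coend
  comulA comul1l comul1r comulDl comulDr.

(* M as a left S-module, s m = s(m) *)
Definition endmod : Type := M.
HB.instance Definition _ := RModule.on endmod.

Definition endmod_scale (s : coend) (m : endmod) : endmod := s m.

Fact endmod_scaleA s t m :
  endmod_scale s (endmod_scale t m) = endmod_scale (s * t) m.
Proof. by []. Qed.
Fact endmod_scale1 : left_id 1 endmod_scale.
Proof. by []. Qed.
Fact endmod_scaleDr : right_distributive endmod_scale +%R.
Proof. by move=> s m n; apply: (rlinearD (cohom_rlinear s)). Qed.
Fact endmod_scaleDl m : {morph endmod_scale^~ m : s t / s + t}.
Proof. by []. Qed.

HB.instance Definition _ := GRing.Zmodule_isLmodule.Build coend endmod
  endmod_scaleA endmod_scale1 endmod_scaleDr endmod_scaleDl.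

Fact endmod_bimodA (s : coend) (m : endmod) (a : A) :
  s *: (m <* a) = (s *: m) <* a.
Proof. exact: (rlinearZ (cohom_rlinear s)). Qed.

HB.instance Definition _ :=
  LRModule_isBimodule.Build coend A endmod endmod_bimodA.

Lemma endmod_scaleE (s : coend) (m : endmod) : s *: m = s m.
Proof. by []. Qed.

(* Hom^{-C}(M, N) as a right S-module, f s = f \o s *)
Variable N : rcomodule.

Definition cohom_ract (f : cohom M N) (s : coend) : cohom M N := cocomp f s.

Fact cohom_ractA f s t : cohom_ract (cohom_ract f s) t = cohom_ract f (s * t).
Proof. exact: cohom_ext. Qed.
Fact cohom_ract1 f : cohom_ract f 1 = f.
Proof. exact: cohom_ext. Qed.
Fact cohom_ractDl s : {morph cohom_ract^~ s : f g / f + g}.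
Proof. by move=> f g; apply: cohom_ext. Qed.
Fact cohom_ractDr f : {morph cohom_ract f : s t / s + t}.
Proof.
by move=> s t; apply: cohom_ext => m; apply: (rlinearD (cohom_rlinear f)).
Qed.

HB.instance Definition _ := Zmodule_isRModule.Build coend (cohom M N)
  cohom_ractA cohom_ract1 cohom_ractDl cohom_ractDr.

Lemma cohom_ractE (f : cohom M N) (s : coend) m : (f <* s) m = f (s m).
Proof. by []. Qed.

End CoEnd.

(* Hom^{-C}(M, N) ⊗_S M is a right C-comodule via Hom^{-C}(M, N) ⊗_S rho^M,
   i.e. f ⊗ m |-> (f ⊗ m_(0)) ⊗ m_(1) *)
Section HomTensor.
Variables M N : rcomodule.

Definition hom_tensor : Type := tensor (cohom M N) (endmod M).
HB.instance Definition _ := RModule.on hom_tensor.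

Definition hom_pure (f : cohom M N) (m : M) : hom_tensor := f ⊗ (m : endmod M).

Definition hom_tensor_coact : hom_tensor -> tensor hom_tensor C :=
  tlift (fun (f : cohom M N) (m : endmod M) =>
    tmap (hom_pure f) idfun (rcoact (m : M))).

Lemma hom_pure_rlinear f : rlinear (hom_pure f).
Proof.
move=> a u v; rewrite /hom_pure tpureDr; congr (_ + _).
exact/esym/(@tract_pure _ _ (cohom M N) (endmod M)).
Qed.

Lemma hom_tensor_coact_balanced :
  balanced (fun (f : cohom M N) (m : endmod M) =>
    tmap (hom_pure f) idfun (rcoact (m : M))).
Proof.
have hl := hom_pure_rlinear.
split=> [f g m|f m n|f s m].
- elim/tensor_ind: (rcoact _) => [x c|x y IHx IHy].
    by rewrite !tmap_pure// -tpureDl; congr (_ ⊗ _); apply: tpureDl.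
  by rewrite !tmapD// IHx IHy addrACA.
- by rewrite (rlinearD (@rcoact_rlinear M)) tmapD.
- have [sl sP] := cohomP s; rewrite endmod_scaleE sP tmap_comp//.
  apply: eq_tmap => // x; exact: tpure_bal.
Qed.

Lemma hom_tensor_coact_pure f m :
  hom_tensor_coact (hom_pure f m) = tmap (hom_pure f) idfun (rcoact m).
Proof. exact: (tlift_pure hom_tensor_coact_balanced). Qed.

Lemma hom_tensor_coactD : {morph hom_tensor_coact : x y / x + y}.
Proof. exact: tliftD hom_tensor_coact_balanced. Qed.

Fact hom_tensor_coact_rlinear : rlinear hom_tensor_coact.
Proof.
move=> a x y; rewrite hom_tensor_coactD; congr (_ + _).
elim/tensor_ind: x => [f m|x z IHx IHz]; last first.
  by rewrite ractDl !hom_tensor_coactD ractDl IHx IHz.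
rewrite -[f ⊗ m]/(hom_pure f m) -(rlinearZ (@hom_pure_rlinear f)).
rewrite !hom_tensor_coact_pure (rlinearZ (@rcoact_rlinear M)).
by apply/rlinearZ/tmap_rlinear => //; apply: hom_pure_rlinear.
Qed.

Fact hom_tensor_coassoc x :
  tassoc (tmap hom_tensor_coact idfun (hom_tensor_coact x)) =
  tmap idfun (@cdelta k A C) (hom_tensor_coact x).
Proof.
have cl := hom_tensor_coact_rlinear; have rl := @rcoact_rlinear M.
have dl := @cdelta_linear k A C.
elim/tensor_ind: x => [f m|x y IHx IHy]; last first.
  by rewrite hom_tensor_coactD !tmapD// tassocD IHx IHy.
have hl := @hom_pure_rlinear f.
have tl : rlinear (tmap (hom_pure f) (@idfun C)) by apply: tmap_rlinear.
rewrite -[f ⊗ m]/(hom_pure f m) hom_tensor_coact_pure !tmap_comp//.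
rewrite (@eq_tmap _ _ _ _ _ _
  (tmap (hom_pure f) idfun \o @rcoact M) _ idfun)//; last first.
  by move=> u /=; rewrite hom_tensor_coact_pure.
have -> : tmap (tmap (hom_pure f) idfun \o @rcoact M) idfun (rcoact m) =
    tmap (tmap (hom_pure f) (@idfun C)) (@idfun C)
      (tmap (@rcoact M) idfun (rcoact m)) by rewrite tmap_comp.
rewrite tassoc_tmap// rcoact_coassoc tmap_comp//; last by move=> a u v; rewrite !tmap_id.
by apply: eq_tmap => // c /=; rewrite tmap_id.
Qed.

Lemma rcounit_balanced (X : rmodType A) :
  balanced (fun (m : X) (c : C) => m <* ceps c).
Proof.
have eD c d : ceps (c + d) = ceps c + ceps d :> A.
  by have := ceps_linear 1 c d; rewrite scale1r mul1r.
have e0 : ceps (0 : C) = 0 :> A.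
  by apply: (addrI (ceps (0 : C))); rewrite -eD !addr0.
split=> [m m' c|m c d|m a c].
- by rewrite ractDl.
- by rewrite eD ractDr.
- by have := ceps_linear a c 0; rewrite ractA e0 !addr0 => ->.
Qed.

Fact hom_tensor_counit x :
  tlift (fun m0 m1 => m0 <* ceps m1) (hom_tensor_coact x) = x.
Proof.
have hb := rcounit_balanced.
elim/tensor_ind: x => [f m|x y IHx IHy]; last first.
  by rewrite hom_tensor_coactD (tliftD (hb _)) IHx IHy.
have hl := @hom_pure_rlinear f.
rewrite -[f ⊗ m]/(hom_pure f m) hom_tensor_coact_pure -{2}(rcoact_counit m).
elim/tensor_ind: (rcoact m) => [u c|x y IHx IHy].
  by rewrite tmap_pure// !(tlift_pure (hb _)) (rlinearZ hl).
by rewrite tmapD// !(tliftD (hb _)) IHx IHy (rlinearD hl).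
Qed.

Definition hom_tensor_rcomod : rcomodule :=
  RComodule hom_tensor_coact_rlinear hom_tensor_coassoc hom_tensor_counit.

Definition hom_eval : hom_tensor -> N :=
  tlift (fun (f : cohom M N) (m : endmod M) => f m).

Lemma hom_eval_balanced :
  balanced (fun (f : cohom M N) (m : endmod M) => f m).
Proof. by split=> // f m n; apply: (rlinearD (cohom_rlinear f)). Qed.

Lemma hom_eval_pure (f : cohom M N) (m : M) : hom_eval (hom_pure f m) = f m.
Proof. exact: (tlift_pure hom_eval_balanced). Qed.

End HomTensor.

(* phi_C : Hom^{-C}(M, C) ⊗_S M -> C, f ⊗ m |-> f(m) *)
Definition galois_map (M : rcomodule) :
  hom_tensor_rcomod M coring_rcomod -> coring_rcomod :=
  @hom_eval M coring_rcomod.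

Definition galois_rcomod (M : rcomodule) : Prop :=
  [/\ fin_gen_right M, projective_right M & rcomod_iso (@galois_map M)].

Definition principal_rcomod (M : rcomodule) : Prop :=
  galois_rcomod M /\ projective_left (endmod M).

Section DualComodule.
Variable M : rcomodule.
Implicit Types xi : dual M.

(* m ⊗ n |-> xi(m) n; in particular [dual_ctr xi (rcoact m)] is
   xi(m_(0)) m_(1) *)
Definition dual_ctr (N : lmodType A) xi : tensor M N -> N :=
  tlift (fun m n => xi m *: n).

Lemma dual_ctr_balanced (N : lmodType A) xi :
  balanced (fun m (n : N) => xi m *: n).
Proof.
split=> [m m' n|m n n'|m a n].
- by rewrite dualD scalerDl.
- by rewrite scalerDr.
- by rewrite dualZ scalerA.
Qed.

Lemma dual_ctr_pure (N : lmodType A) xi m (n : N) :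
  dual_ctr xi (m ⊗ n) = xi m *: n.
Proof. exact/tlift_pure/dual_ctr_balanced. Qed.

Lemma dual_ctrD (N : lmodType A) xi : {morph @dual_ctr N xi : x y / x + y}.
Proof. exact/tliftD/dual_ctr_balanced. Qed.

Lemma dual_ctrDl (N : lmodType A) xi eta x :
  dual_ctr (xi + eta) x = dual_ctr xi x + dual_ctr eta x :> N.
Proof.
elim/tensor_ind: x => [m c|x y IHx IHy].
  by rewrite !dual_ctr_pure dualDE scalerDl.
by rewrite !dual_ctrD IHx IHy addrACA.
Qed.

Lemma dual_ctrZl (N : lmodType A) (a : A) xi x :
  dual_ctr (a *: xi) x = a *: dual_ctr xi x :> N.
Proof.
elim/tensor_ind: x => [m c|x y IHx IHy].
  by rewrite !dual_ctr_pure dual_scaleE scalerA.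
by rewrite !dual_ctrD IHx IHy scalerDr.
Qed.

Lemma dual_ctr_rlinear (N : bimodType A A) xi : rlinear (@dual_ctr N xi).
Proof.
move=> a x y; rewrite dual_ctrD; congr (_ + _).
elim/tensor_ind: x => [m c|x z IHx IHz].
  by rewrite tract_pure !dual_ctr_pure bimodA.
by rewrite ractDl !dual_ctrD IHx IHz ractDl.
Qed.

Lemma dual_ctr_nat (N N' : lmodType A) (g : N -> N') xi x :
  linear g -> g (dual_ctr xi x) = dual_ctr xi (tmap idfun g x).
Proof.
move=> gl; elim/tensor_ind: x => [m c|x z IHx IHz].
  by rewrite tmap_pure// !dual_ctr_pure linear_scale.
by rewrite tmapD// !dual_ctrD linear_add// IHx IHz.
Qed.

Lemma dual_ctr_assoc (N : bimodType A A) (P : lmodType A) xi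
    (x : tensor (tensor M N) P) :
  dual_ctr xi (tassoc x) = tmap (@dual_ctr N xi) idfun x.
Proof.
have cl := @dual_ctr_rlinear N xi.
elim/tensor_ind: x => [x p|x y IHx IHy]; last first.
  by rewrite tassocD dual_ctrD IHx IHy tmapD.
elim/tensor_ind: x => [m n|x y IHx IHy]; last first.
  by rewrite tpureDl tassocD dual_ctrD IHx IHy tmapD.
by rewrite tassoc_pure tmap_pure// !dual_ctr_pure tscale_pure.
Qed.

Lemma cdelta_dual_ctr xi m :
  cdelta (dual_ctr xi (rcoact m)) =
  tmap (fun u => dual_ctr xi (rcoact u)) idfun (rcoact m).
Proof.
rewrite (dual_ctr_nat _ _ (@cdelta_linear k A C)) -rcoact_coassoc.
rewrite dual_ctr_assoc tmap_comp//; first exact: dual_ctr_rlinear.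
exact: rcoact_rlinear.
Qed.

Lemma dual_ctr_coact_rlinear xi :
  rlinear (fun m : M => dual_ctr xi (rcoact m)).
Proof.
by move=> a u v; rewrite rcoact_rlinear dual_ctr_rlinear.
Qed.

(* M^* ⊗_k M -> C, xi ⊗ m |-> xi(m_(0)) m_(1) *)
Definition can_tilde : tensor (dual M) (kspace M) -> C :=
  tlift (fun xi (m : kspace M) => dual_ctr xi (rcoact (m : M))).

Lemma can_tilde_balanced :
  balanced (fun xi (m : kspace M) => dual_ctr xi (rcoact (m : M))).
Proof.
split=> [xi eta m|xi m n|xi l m].
- exact: dual_ctrDl.
- exact: (rlinearD (dual_ctr_coact_rlinear xi)).
- rewrite dual_kactE dual_ctrZl coring_kcentral.
  exact/esym/(rlinearZ (dual_ctr_coact_rlinear xi)).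
Qed.

Lemma can_tilde_pure xi (m : kspace M) :
  can_tilde (xi ⊗ m) = dual_ctr xi (rcoact (m : M)).
Proof. exact: (tlift_pure can_tilde_balanced). Qed.

Variable B : dual_basis M.

(* xi |-> \sum_i xi(e^i_(0)) e^i_(1) ⊗ xi^i *)
Definition dual_coact xi : tensor C (dual M) :=
  \sum_i dual_ctr xi (rcoact (db_elt (d := B) i)) ⊗ db_form i.

Fact dual_coact_linear : linear dual_coact.
Proof.
move=> a xi eta; rewrite /dual_coact scaler_sumr -big_split/=.
apply: eq_bigr => i _.
by rewrite dual_ctrDl dual_ctrZl tpureDl tscale_pure.
Qed.

Lemma dual_basis_ctr xi m :
  cdelta (dual_ctr xi (rcoact m)) =
  \sum_i dual_ctr xi (rcoact (db_elt (d := B) i)) ⊗ dual_ctr (db_form i) (rcoact m).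
Proof.
have rl := dual_ctr_coact_rlinear xi.
rewrite cdelta_dual_ctr; elim/tensor_ind: (rcoact m) => [u c|x y IHx IHy].
  rewrite tmap_pure// {1}(db_eq B u) (rlinear_sum rl) tpure_suml.
  by apply: eq_bigr => i _; rewrite dual_ctr_pure (rlinearZ rl) tpure_bal.
rewrite tmapD// IHx IHy -big_split; apply: eq_bigr => i _ /=.
by rewrite dual_ctrD tpureDr.
Qed.

Fact dual_coassoc xi :
  tassoc (tmap (@cdelta k A C) idfun (dual_coact xi)) =
  tmap idfun dual_coact (dual_coact xi).
Proof.
have dl := @cdelta_rlinear k A C; have cl := dual_coact_linear.
have tb : {morph (fun x => tassoc (tmap (@cdelta k A C) (@idfun (dual M)) x)) :
    x y / x + y}.
  by move=> x y; rewrite tmapD// tassocD.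
have t0 : tassoc (tmap (@cdelta k A C) (@idfun (dual M)) 0) = 0.
  by apply: (addrI (tassoc (tmap (@cdelta k A C) idfun 0))); rewrite -tb !addr0.
rewrite {1}/dual_coact (big_morph _ tb t0).
under eq_bigr => j _.
  rewrite tmap_pure// dual_basis_ctr tpure_suml.
  rewrite (big_morph _ (@tassocD _ _ _ _ _) (linear_zero (@tassoc_linear _ _ _ _ _ _))).
  under eq_bigr do rewrite tassoc_pure.
  over.
rewrite exchange_big/= /dual_coact (linear_big (tmap_linear _ _ cl))//.
by apply: eq_bigr => i _; rewrite tmap_pure// tpure_sumr.
Qed.

Lemma lcounit_balanced (X : lmodType A) :
  balanced (fun (c : C) (x : X) => ceps c *: x).
Proof.
have eD c d : ceps (c + d) = ceps c + ceps d :> A.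
  by have := ceps_linear 1 c d; rewrite scale1r mul1r.
have e0 : ceps (0 : C) = 0 :> A.
  by apply: (addrI (ceps (0 : C))); rewrite -eD !addr0.
split=> [c d x|c x y|c a x].
- by rewrite eD scalerDl.
- by rewrite scalerDr.
- by have := ceps_rlinear a c 0; rewrite scalerA e0 !addr0 => ->.
Qed.

Lemma ceps_dual_ctr xi m : ceps (dual_ctr xi (rcoact m)) = xi m.
Proof.
have eD c d : ceps (c + d) = ceps c + ceps d :> A.
  by have := ceps_linear 1 c d; rewrite scale1r mul1r.
have e0 : ceps (0 : C) = 0 :> A.
  by apply: (addrI (ceps (0 : C))); rewrite -eD !addr0.
have rb := rcounit_balanced M.
rewrite -{2}(rcoact_counit m); elim/tensor_ind: (rcoact m) => [u c|x y IHx IHy].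
  rewrite dual_ctr_pure (tlift_pure rb) dualZ.
  by have := ceps_linear (xi u) c 0; rewrite e0 !addr0.
by rewrite dual_ctrD eD IHx IHy (tliftD rb) dualD.
Qed.

Fact dual_counit xi :
  tlift (fun (m1 : C) m0 => ceps m1 *: m0) (dual_coact xi) = xi.
Proof.
have lb := lcounit_balanced (dual M).
rewrite /dual_coact (tlift_sum lb); apply: dual_ext => m.
rewrite [in RHS](db_eq B m) dual_sum.
under eq_bigr do rewrite (tlift_pure lb) ceps_dual_ctr.
rewrite (big_morph (fun f : dual M => f m) (id1 := 0) (op1 := +%R))//.
by apply: eq_bigr => i _; rewrite dualZ.
Qed.

Definition dual_lcomod : lcomodule :=
  LComodule dual_coact_linear dual_coassoc dual_counit.

(* The left C-comodule M^* ⊗_k M with coaction rho ⊗_k M; for fixed m, the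
   map rho(-) ⊗ m, with C ⊗_A M^* ⊗_k M as target, is the composite of
   rho and C ⊗_A (- ⊗ m). *)
Definition dual_tensor : Type := tensor (dual M) (kspace M).
HB.instance Definition _ := GRing.Lmodule.on dual_tensor.

Definition dual_pure (m : kspace M) xi : dual_tensor := xi ⊗ m.

Definition dual_tensor_coact : dual_tensor -> tensor C dual_tensor :=
  tlift (fun xi m => tmap idfun (dual_pure m) (dual_coact xi)).

Lemma dual_pure_linear m : linear (dual_pure m).
Proof.
move=> a xi eta; rewrite /dual_pure tpureDl; congr (_ + _).
exact/esym/(@tscale_pure _ _ (dual M) (kspace M)).
Qed.

Lemma dual_tensor_coact_balanced :
  balanced (fun xi (m : kspace M) => tmap idfun (dual_pure m) (dual_coact xi)).
Proof.
have pl := dual_pure_linear.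
split=> [xi eta m|xi m n|xi l m].
- by rewrite (linear_add dual_coact_linear) tmapD.
- elim/tensor_ind: (dual_coact xi) => [c eta|x y IHx IHy].
    by rewrite !tmap_pure// -tpureDr; congr (_ ⊗ _); apply: tpureDr.
  by rewrite !tmapD// IHx IHy addrACA.
- rewrite dual_kactE (linear_scale dual_coact_linear).
  elim/tensor_ind: (dual_coact xi) => [c eta|x y IHx IHy].
    rewrite tscale_pure !tmap_pure//= coring_kcentral tpure_bal.
    congr (_ ⊗ _); rewrite -(linear_scale (pl m)) -dual_kactE.
    exact: tpure_bal.
  by rewrite scalerDr !tmapD// IHx IHy.
Qed.

Lemma dual_tensor_coact_pure m xi :
  dual_tensor_coact (dual_pure m xi) = tmap idfun (dual_pure m) (dual_coact xi).
Proof. exact: (tlift_pure dual_tensor_coact_balanced). Qed.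

Lemma dual_tensor_coactD : {morph dual_tensor_coact : x y / x + y}.
Proof. exact: tliftD dual_tensor_coact_balanced. Qed.

Fact dual_tensor_coact_linear : linear dual_tensor_coact.
Proof.
move=> a x y; rewrite dual_tensor_coactD; congr (_ + _).
elim/tensor_ind: x => [xi m|x z IHx IHz]; last first.
  by rewrite scalerDr !dual_tensor_coactD scalerDr IHx IHz.
rewrite -[xi ⊗ m]/(dual_pure m xi) -(linear_scale (@dual_pure_linear m)).
rewrite !dual_tensor_coact_pure (linear_scale dual_coact_linear).
by apply/linear_scale/tmap_linear => //; apply: dual_pure_linear.
Qed.

Fact dual_tensor_coassoc x :
  tassoc (tmap (@cdelta k A C) idfun (dual_tensor_coact x)) =
  tmap idfun dual_tensor_coact (dual_tensor_coact x).
Proof.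
have cl := dual_tensor_coact_linear; have rl := dual_coact_linear.
have dl := @cdelta_rlinear k A C; have dl' := @cdelta_linear k A C.
elim/tensor_ind: x => [xi m|x y IHx IHy]; last first.
  by rewrite dual_tensor_coactD !tmapD// tassocD IHx IHy.
have hl := @dual_pure_linear m.
have tl : linear (tmap (@idfun C) (dual_pure m)) by apply: tmap_linear.
rewrite -[xi ⊗ m]/(dual_pure m xi) dual_tensor_coact_pure !tmap_comp//.
rewrite (@eq_tmap _ _ _ _ _ (idfun \o idfun) idfun
  (dual_tensor_coact \o dual_pure m)
  (tmap idfun (dual_pure m) \o dual_coact))//; last first.
  by move=> u /=; rewrite dual_tensor_coact_pure.
have -> : tmap (idfun \o idfun) (tmap idfun (dual_pure m) \o dual_coact)
      (dual_coact xi) =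
    tmap (@idfun C) (tmap (@idfun C) (dual_pure m))
      (tmap idfun dual_coact (dual_coact xi)) by rewrite tmap_comp.
rewrite -dual_coassoc -tassoc_tmap// tmap_comp//; last first.
  by move=> a u v; rewrite !tmap_id.
by congr tassoc; apply: eq_tmap => // c /=; rewrite tmap_id.
Qed.

Fact dual_tensor_counit x :
  tlift (fun (m1 : C) m0 => ceps m1 *: m0) (dual_tensor_coact x) = x.
Proof.
have hb := lcounit_balanced.
elim/tensor_ind: x => [xi m|x y IHx IHy]; last first.
  by rewrite dual_tensor_coactD (tliftD (hb _)) IHx IHy.
have hl := @dual_pure_linear m.
rewrite -[xi ⊗ m]/(dual_pure m xi) dual_tensor_coact_pure -{2}(dual_counit xi).
elim/tensor_ind: (dual_coact xi) => [c u|x y IHx IHy].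
  by rewrite tmap_pure// !(tlift_pure (hb _)) (linear_scale hl).
by rewrite tmapD// !(tliftD (hb _)) IHx IHy (linear_add hl).
Qed.

Definition dual_tensor_lcomod : lcomodule :=
  LComodule dual_tensor_coact_linear dual_tensor_coassoc dual_tensor_counit.

Definition can_map : dual_tensor_lcomod -> coring_lcomod := can_tilde.

End DualComodule.

End Comodules.

Arguments can_map {k A C M} B _.
Arguments galois_map {k A C} M _.

(* Main.v *)
From HB Require Import structures.
Require Import Defs.
From mathcomp Require Import all_boot all_algebra.
From mathcomp Require Import boolp classical_sets functions fsbigop.

Set Implicit Arguments.
Unset Strict Implicit.
Unset Printing Implicit Defensive.

Import GRing.Theory.
Local Open Scope ring_scope.

(** Write [c(xi, m) = xi(m_(0)) m_(1)] for the matrix coefficients of [M]. They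
    identify M^* with Hom^{-C}(M, C) by [xi |-> c(xi, -)], with inverse
    composition with the counit ([coefficient_hom_counit_form],
    [counit_form_coefficient_hom]). Under this identification the Galois map is
    [xi ⊗_S m |-> c(xi, m)], so that the map of condition (1) is the Galois map
    precomposed with the projection of [M^* ⊗_k M] onto [M^* ⊗_S M].

    Projectivity is handled by means of possibly infinite dual bases: a left
    module is projective iff it has one, which moreover makes it flat. Since [k]
    is a field, Zorn's lemma gives a dual basis [psi] of the vector space [M],
    indexed by the elements of [M] themselves. Applying [psi n] to the second
    factor cuts [M^* ⊗_k M] into slices, which are left colinear maps to M^*.

    From (1) to (2), let [sigma] be a colinear section and [tau n : C -> M^*] the
    slices of [sigma]. For a left colinear [tau : C -> M^*], the element
    [m_(0) ⊗ tau(m_(1))] lies in the cotensor product of [M] and M^*, that is, it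
    is an element of [S]: the endomorphism [u |-> m_(0) tau(m_(1))(u)] is
    colinear ([cotensor_endo]). For [tau = tau n] it depends S-linearly on [m],
    and these functionals form a dual basis of the left S-module [M]
    ([section_dual_basis]), which is therefore projective. The Galois map is
    inverted by [sigma] followed by the projection to [M^* ⊗_S M]: as [tau] is left
    A-linear, [tau n (c(xi, m))] is the composite of [xi] with the endomorphism
    attached to [tau n] and [m], which can be moved across the tensor product
    over [S] ([galois_mapK]).

    From (2) to (1), a dual basis [phi] of the left S-module [M] gives the map
    [xi ⊗_S m |-> \sum_n (xi \o phi_n(m)) ⊗ n], a section of the projection of
    [M^* ⊗_k M] onto [M^* ⊗_S M]; composing it with the inverse of the Galois map
    yields a section of the map of (1), and colinearity is checked on matrix
    coefficients, which generate [C] ([can_section_colinear]). Such a section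
    makes [C] a left A-linear direct summand of [M^* ⊗_k M], which is projective
    because M^* is so over [A] and [M] over [k]; hence [C] is flat
    ([linear_section_flat]). *)

(** * Finitely supported sums *)

Section FiniteSupport.
Variables (I : choiceType) (X : zmodType).
Implicit Types (F G : I -> X) (s : seq I).

Definition fin_supported F := exists s, forall i, i \notin s -> F i = 0.

Lemma fin_supported_uniq F :
  fin_supported F -> exists s, uniq s /\ forall i, i \notin s -> F i = 0.
Proof.
move=> [s hs]; exists (undup s); split; first exact: undup_uniq.
by move=> i; rewrite mem_undup; apply: hs.
Qed.

Lemma fin_supported2 F G : fin_supported F -> fin_supported G ->
  exists s, [/\ uniq s, forall i, i \notin s -> F i = 0
                      & forall i, i \notin s -> G i = 0].
Proof.
move=> [s hs] [t ht]; exists (undup (s ++ t)).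
split; first exact: undup_uniq.
  by move=> i; rewrite mem_undup mem_cat negb_or => /andP[/hs].
by move=> i; rewrite mem_undup mem_cat negb_or => /andP[_ /ht].
Qed.

Lemma fsumE s F : uniq s -> (forall i, i \notin s -> F i = 0) ->
  \sum_(i \in [set: I]) F i = \sum_(i <- s) F i.
Proof.
move=> us hs; rewrite (fsbigE s)//; last by move=> i _; apply: hs.
by apply: eq_bigl => i; rewrite in_setT.
Qed.

Lemma fin_supportedD F G : fin_supported F -> fin_supported G ->
  fin_supported (fun i => F i + G i).
Proof.
move=> Fs Gs; have [s [_ hF hG]] := fin_supported2 Fs Gs.
by exists s => i si; rewrite hF// hG// addr0.
Qed.

Lemma fsumD F G : fin_supported F -> fin_supported G ->
  \sum_(i \in [set: I]) (F i + G i) =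
  \sum_(i \in [set: I]) F i + \sum_(i \in [set: I]) G i.
Proof.
move=> Fs Gs; have [s [us hF hG]] := fin_supported2 Fs Gs.
rewrite !(fsumE us)// ?big_split// => i si.
by rewrite hF// hG// addr0.
Qed.

End FiniteSupport.

Lemma fsum_morph (I : choiceType) (X Y : zmodType) (F : I -> X) (g : X -> Y) :
    {morph g : x y / x + y} -> fin_supported F ->
  g (\sum_(i \in [set: I]) F i) = \sum_(i \in [set: I]) g (F i).
Proof.
move=> gD /fin_supported_uniq[s [us hs]].
have g0 : g 0 = 0 by apply: (addrI (g 0)); rewrite -gD !addr0.
rewrite !(fsumE us)// ?(big_morph _ gD g0)// => i /hs ->; exact: g0.
Qed.

(** * Dual bases, projectivity and flatness *)

(** The index set may be infinite; only finitely many [phi i p] are nonzero for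
    a given [p], so that the expansion of [p] makes sense. *)
Definition left_dual_basis (R : pzRingType) (P : lmodType R) (I : choiceType)
    (b : I -> P) (phi : I -> P -> R) : Prop :=
  [/\ forall i a u v, phi i (a *: u + v) = a * phi i u + phi i v,
      forall p, fin_supported (phi^~ p)
    & forall p, p = \sum_(i \in [set: I]) phi i p *: b i].

Section DualBasis.
Variables (R : pzRingType) (P : lmodType R) (I : choiceType).
Variables (b : I -> P) (phi : I -> P -> R).
Hypothesis bP : left_dual_basis b phi.

Lemma dual_basisD i u v : phi i (u + v) = phi i u + phi i v.
Proof. by case: bP => + _ _ => /(_ i 1 u v); rewrite scale1r mul1r. Qed.

Lemma dual_basis0 i : phi i 0 = 0.
Proof. by apply: (addrI (phi i 0)); rewrite -dual_basisD !addr0. Qed.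

Lemma dual_basisZ i a u : phi i (a *: u) = a * phi i u.
Proof. by case: bP => + _ _ => /(_ i a u 0); rewrite dual_basis0 !addr0. Qed.

Lemma dual_basis_supported p : fin_supported (phi^~ p).
Proof. by case: bP. Qed.

Lemma dual_basis_sum p : \sum_(i \in [set: I]) phi i p *: b i = p.
Proof. by case: bP. Qed.

Lemma dual_basis_supportedZ (X : lmodType R) (c : I -> X) p :
  fin_supported (fun i => phi i p *: c i).
Proof.
have [s hs] := dual_basis_supported p.
by exists s => i /hs ->; rewrite scale0r.
Qed.

Lemma dual_basis_projective : projective_left P.
Proof.
move=> X Y p f pl fl p_surj.
have [c cP] := choice (fun i => p_surj (f (b i))).
have sc := @dual_basis_supportedZ X c.
exists (fun u => \sum_(i \in [set: I]) phi i u *: c i); split.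
  move=> a u v; rewrite (fsum_morph (scalerDr a) (sc u)) -fsumD//; last first.
    by have [s hs] := sc u; exists s => i /hs ->; rewrite scaler0.
  by apply: eq_fsbigr => i _; rewrite dual_basisD dual_basisZ scalerDl scalerA.
move=> u; rewrite (fsum_morph (linear_add pl))//.
rewrite -[in RHS](dual_basis_sum u) (fsum_morph (linear_add fl)); last first.
  exact: dual_basis_supportedZ.
by apply: eq_fsbigr => i _; rewrite (linear_scale pl) (linear_scale fl) cP.
Qed.

(** Each functional [phi i] induces an additive map [X ⊗ P -> X], natural in
    [X], and these coordinates determine the elements of [X ⊗ P]. *)
Lemma dual_basis_flat : flat_left P.
Proof.
move=> X Y f fl f_inj.
have fb i (Z : rmodType R) : balanced (fun (x : Z) p => x <* phi i p).
  split=> [x y p|x p q|x a p]; first by rewrite ractDl.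
    by rewrite dual_basisD ractDr.
  by rewrite ractA dual_basisZ.
pose coef (Z : rmodType R) i (z : tensor Z P) : Z :=
  tlift (fun x p => x <* phi i p) z.
have coefD Z i : {morph @coef Z i : x y / x + y} by apply: tliftD.
have coefE Z i x p : @coef Z i (x ⊗ p) = x <* phi i p by apply: tlift_pure.
have key (z : tensor X P) : fin_supported (fun i => coef X i z) /\
    z = \sum_(i \in [set: I]) coef X i z ⊗ b i.
  elim/tensor_ind: z => [x p|z z' [zs zE] [zs' zE']].
    have sxp : fin_supported (fun i => coef X i (x ⊗ p)).
      have [s hs] := dual_basis_supported p.
      by exists s => i /hs e; rewrite coefE e ract0r.
    split=> //; rewrite -{1}(dual_basis_sum p).
    rewrite (fsum_morph (g := fun q => x ⊗ q)) => [||].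
    - by apply: eq_fsbigr => i _; rewrite coefE tpure_bal.
    - exact: tpureDr.
    - exact: dual_basis_supportedZ.
  have tz y : fin_supported (fun i => coef X i y) ->
      fin_supported (fun i => coef X i y ⊗ b i).
    by case=> s hs; exists s => i /hs ->; rewrite tpure0l.
  split.
    have -> : (fun i => coef X i (z + z')) = (fun i => coef X i z + coef X i z').
      by apply/funext => i; rewrite coefD.
    exact: fin_supportedD.
  rewrite {1}zE {1}zE' -fsumD; try exact: tz.
  by apply: eq_fsbigr => i _; rewrite coefD tpureDl.
have coefM i z : coef Y i (tmap f idfun z) = f (coef X i z).
  elim/tensor_ind: z => [x p|z z' IH IH'].
    by rewrite tmap_pure// !coefE (rlinearZ fl).
  by rewrite tmapD// !coefD (rlinearD fl) IH IH'.
move=> z z' zz'; rewrite (key z).2 (key z').2.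
by apply: eq_fsbigr => i _; congr (_ ⊗ _); apply: f_inj; rewrite -!coefM zz'.
Qed.

End DualBasis.

(** * Free modules and vector spaces *)

Section FreeModule.
Variables (R : pzRingType) (I : choiceType).

Definition free_pred : {pred I -> R} := fun f => `[< fin_supported f >].

Fact free_zmod_closed : zmod_closed free_pred.
Proof.
split=> [|f g /asboolP fs /asboolP gs]; apply/asboolP; first by exists [::].
have [s [_ hf hg]] := fin_supported2 fs gs.
exists s => i si; change (f i - g i = 0).
by rewrite hf// hg// subr0.
Qed.
HB.instance Definition _ :=
  GRing.isZmodClosed.Build (I -> R) free_pred free_zmod_closed.

Record free_module := FreeModule {
  free_fun :> I -> R; _ : free_fun \in free_pred }.

HB.instance Definition _ := [isSub for free_fun].
HB.instance Definition _ := [Choice of free_module by <:].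
HB.instance Definition _ := [SubChoice_isSubZmodule of free_module by <:].

Lemma free_supported (f : free_module) : fin_supported f.
Proof. by case: f => f fP; apply/asboolP. Qed.

Lemma free_ext (f g : free_module) : f =1 g -> f = g.
Proof. by move=> fg; apply/val_inj/funext/fg. Qed.

Fact free_scale_subproof (a : R) (f : free_module) :
  (fun i => a * f i) \in free_pred.
Proof.
apply/asboolP; have [s hs] := free_supported f.
by exists s => i /hs ->; rewrite mulr0.
Qed.
Definition free_scale a f := FreeModule (free_scale_subproof a f).

Fact free_scaleA a b f : free_scale a (free_scale b f) = free_scale (a * b) f.
Proof. by apply: free_ext => i /=; rewrite mulrA. Qed.
Fact free_scale1 : left_id 1 free_scale.
Proof. by move=> f; apply: free_ext => i /=; rewrite mul1r. Qed.
Fact free_scaleDr : right_distributive free_scale +%R.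
Proof. by move=> a f g; apply: free_ext => i /=; rewrite mulrDr. Qed.
Fact free_scaleDl f : {morph free_scale^~ f : a b / a + b}.
Proof. by move=> a b; apply: free_ext => i /=; rewrite mulrDl. Qed.

HB.instance Definition _ := GRing.Zmodule_isLmodule.Build R free_module
  free_scaleA free_scale1 free_scaleDr free_scaleDl.

Fact free_delta_subproof (i : I) : (fun j => (j == i)%:R : R) \in free_pred.
Proof.
by apply/asboolP; exists [:: i] => j; rewrite inE => /negbTE ->.
Qed.
Definition free_delta i := FreeModule (free_delta_subproof i).

Variables (P : lmodType R) (b : I -> P).

Definition free_eval (f : free_module) : P := \sum_(i \in [set: I]) f i *: b i.

Lemma free_eval_supported (f : free_module) :
  fin_supported (fun i => f i *: b i).
Proof.
by have [s hs] := free_supported f; exists s => i /hs ->; rewrite scale0r.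
Qed.

Lemma free_eval_linear : linear free_eval.
Proof.
move=> a f g; have es := free_eval_supported.
rewrite /free_eval (fsum_morph (scalerDr a) (es f)) -fsumD//; last first.
  by have [s hs] := es f; exists s => i /hs ->; rewrite scaler0.
by apply: eq_fsbigr => i _; rewrite scalerA -scalerDl.
Qed.

Lemma free_eval_delta i : free_eval (free_delta i) = b i.
Proof.
rewrite /free_eval (fsumE (s := [:: i]))//; last first.
  by move=> j; rewrite inE /= => /negbTE ->; rewrite scale0r.
by rewrite big_seq1 /= eqxx scale1r.
Qed.

End FreeModule.

(** The coordinates of a linear section of the projection of the free module on
    the set [P] onto [P]. *)
Lemma projective_dual_basis (R : pzRingType) (P : lmodType R) :
  projective_left P -> exists phi : P -> P -> R, left_dual_basis idfun phi.
Proof.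
move=> Pproj.
have [] := Pproj (free_module R P) P (free_eval idfun) idfun => //.
- exact: free_eval_linear.
- by move=> p; exists (free_delta R p); rewrite free_eval_delta.
move=> g [gl gK]; exists (fun i p => g p i); split.
- by move=> i a u v; rewrite gl.
- by move=> p; apply: free_supported.
- by move=> p; rewrite -[LHS]gK.
Qed.

(** Zorn's lemma is applied to the graphs of the lifts of [f] defined on a
    subspace of [V]: a maximal one is total, since a lift can be extended to any
    vector outside its domain. *)
Lemma field_projective (k : fieldType) (V : lmodType k) : projective_left V.
Proof.
move=> X Y p f pl fl p_surj.
(* The empty set satisfies these conditions, as the union of the empty chain
   must; a maximal [G] contains [(0, 0)], hence is a subspace. *)
pose graph (G : set (V * X)) := [/\
  forall a u v, G u -> G v -> G (a *: u + v),
  forall x, G (0, x) -> x = 0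
  & forall u, G u -> p u.2 = f u.1].
have [|G [[GL Gf Gp] Gmax]] := @Zorn_bigcup _ graph.
  move=> F Fgraph Ftot; split.
  - move=> a u v [H FH Hu] [H' FH' Hv].
    have [HH'|H'H] := Ftot _ _ FH FH'.
      by exists H' => //; have [+ _ _] := Fgraph _ FH'; apply=> //; apply: HH'.
    by exists H => //; have [+ _ _] := Fgraph _ FH; apply=> //; apply: H'H.
  - by move=> x [H FH Hx]; have [_ + _] := Fgraph _ FH; apply.
  - by move=> u [H FH Hu]; have [_ _ +] := Fgraph _ FH; apply.
have G0 : G (0, 0).
  apply: contrapT => nG0; apply: (Gmax (fun u => G u \/ u = (0, 0))).
    by split=> [u|sub]; [left|apply: nG0; apply: sub; right].
  split.
  - move=> a u v [Gu|->] [Gv|->]; try by left; apply: GL.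
    + left; have -> : a *: u + (0, 0) = (a - 1) *: u + u.
        by rewrite scalerBl scale1r subrK addr0.
      exact: GL.
    + by left; rewrite scaler0 add0r.
    + by right; rewrite scaler0 add0r.
  - by move=> x [/Gf//|[]].
  - by move=> u [/Gp//|->] /=; rewrite (linear_zero pl) (linear_zero fl).
have GZ a u : G u -> G (a *: u) by move=> Gu; rewrite -[a *: u]addr0; apply: GL.
have GD u v : G u -> G v -> G (u + v).
  by move=> Gu Gv; rewrite -[u]scale1r; apply: GL.
have GN u : G u -> G (- u) by move=> Gu; rewrite -scaleN1r; apply: GZ.
have Gtot v : exists x, G (v, x).
  apply: contrapT => nGv; have [x0 x0P] := p_surj (f v).
  (* The linear span of [G] and [(v, x0)]. It is still a graph: an element
     [(u, y)] of [G] with [u = - l v] and [l != 0] would give [v] a value. *)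
  pose H (w : V * X) := exists u l, G u /\ w = u + l *: (v, x0).
  apply: (Gmax H).
    split=> [u Gu|sub]; first by exists u, 0; rewrite scale0r addr0.
    apply: nGv; exists x0; apply: sub.
    by exists 0, 1; rewrite scale1r add0r.
  split.
  - move=> a _ _ [u [l [Gu ->]]] [u' [l' [Gu' ->]]].
    exists (a *: u + u'), (a * l + l'); split; first exact: GL.
    by rewrite scalerDr scalerA scalerDl addrACA.
  - move=> x [[u y] [l [Gu [u0 ->]]]]; have [l0|l0] := eqVneq l 0.
      move: u0 Gu; rewrite l0 !scale0r !addr0 => <-; exact: Gf.
    case: nGv; exists (- l^-1 *: y).
    suff -> : (v, - l^-1 *: y) = - l^-1 *: (u, y) by apply: GZ.
    congr (_, _); have -> : u = - (l *: v) by apply/eqP; rewrite -addr_eq0 -u0.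
    by rewrite scaleNr scalerN opprK scalerA mulVf// scale1r.
  - move=> _ [u [l [Gu ->]]] /=.
    by rewrite (linear_add pl) (linear_scale pl) (linear_add fl)
      (linear_scale fl) x0P Gp.
have [g gP] := choice Gtot.
have Gfun v x y : G (v, x) -> G (v, y) -> x = y.
  move=> Gx Gy; apply/eqP; rewrite -subr_eq0; apply/eqP; apply: Gf.
  suff -> : (0, x - y) = (v, x) - (v, y) by apply/GD/GN.
  by congr (_, _); rewrite subrr.
exists g; split=> [a u v|u]; last exact: (Gp _ (gP u)).
by apply: Gfun (gP _) _; apply: (GL a (u, g u) (v, g v)).
Qed.

(** * Matrix coefficients of a comodule *)

Section Coefficients.
Variables (k : comPzRingType) (A : pzAlgType k) (C : coring A).
Variable M : rcomodule C.
Implicit Types (xi eta : dual M) (m : M) (s : coend M).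

Definition coefficient xi m : C := dual_ctr xi (rcoact m).

Lemma coefficient_rlinear xi : rlinear (coefficient xi).
Proof. exact: dual_ctr_coact_rlinear. Qed.

Lemma coefficientDl xi eta m :
  coefficient (xi + eta) m = coefficient xi m + coefficient eta m.
Proof. exact: dual_ctrDl. Qed.

Lemma coefficientZl a xi m : coefficient (a *: xi) m = a *: coefficient xi m.
Proof. exact: dual_ctrZl. Qed.

Lemma coefficientDr xi : {morph coefficient xi : m n / m + n}.
Proof. exact: rlinearD (coefficient_rlinear xi). Qed.

Fact coefficient_hom_subproof xi :
  coefficient xi \in @cohom_pred k A C M (coring_rcomod C).
Proof.
apply/asboolP; split; first exact: coefficient_rlinear.
by move=> m; apply: cdelta_dual_ctr.
Qed.
Definition coefficient_hom xi : cohom M (coring_rcomod C) :=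
  CoHom (coefficient_hom_subproof xi).

Lemma ceps_additive : {morph @ceps k A C : c d / c + d}.
Proof. by move=> c d; have := ceps_linear 1 c d; rewrite scale1r mul1r. Qed.

Fact counit_form_subproof (f : cohom M (coring_rcomod C)) :
  (fun m => ceps (f m : C)) \in @rform_pred A M.
Proof.
by apply/asboolP => a u v; rewrite (cohom_rlinear f) ceps_rlinear.
Qed.
Definition counit_form f : dual M := Dual (counit_form_subproof f).

(** Colinearity of [f] gives [\sum f(m)_(1) ⊗ f(m)_(2) = \sum f(m_(0)) ⊗ m_(1)];
    the counit is applied to the first factor. *)
Lemma coefficient_counit_form (f : cohom M (coring_rcomod C)) m :
  coefficient (counit_form f) m = f m.
Proof.
have [fl fP] := cohomP f; have cb := lcounit_balanced C C.
rewrite -[RHS](ceps_counitl (f m : C)) -[cdelta _]/(rcoact (f m)) fP.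
rewrite /coefficient.
elim/tensor_ind: (rcoact m) => [u c|x y IHx IHy].
  by rewrite tmap_pure// dual_ctr_pure (tlift_pure cb).
by rewrite dual_ctrD tmapD// (tliftD cb) IHx IHy.
Qed.

Lemma coefficient_hom_counit_form f : coefficient_hom (counit_form f) = f.
Proof. by apply: cohom_ext => m; apply: coefficient_counit_form. Qed.

Lemma counit_form_coefficient_hom xi : counit_form (coefficient_hom xi) = xi.
Proof. by apply: dual_ext => m; apply: ceps_dual_ctr. Qed.

Fact form_comp_subproof xi s : (fun m => xi (s m)) \in @rform_pred A M.
Proof. by apply/asboolP => a u v; rewrite (cohom_rlinear s) dualP. Qed.
Definition form_comp xi s : dual M := Dual (form_comp_subproof xi s).

Lemma coefficient_form_comp xi s m :
  coefficient (form_comp xi s) m = coefficient xi (s m).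
Proof.
have [sl sP] := cohomP s; rewrite /coefficient sP.
elim/tensor_ind: (rcoact m) => [u c|x y IHx IHy].
  by rewrite tmap_pure// !dual_ctr_pure.
by rewrite tmapD// !dual_ctrD IHx IHy.
Qed.

Lemma coefficient_hom_comp xi s :
  coefficient_hom (form_comp xi s) = coefficient_hom xi <* s.
Proof. by apply: cohom_ext => m; apply: coefficient_form_comp. Qed.

Variable B : dual_basis M.

Lemma dual_basis_form xi : xi = \sum_i xi (db_elt (d := B) i) *: db_form i.
Proof.
apply: dual_ext => m; rewrite {1}(db_eq B m) dual_sum.
rewrite (big_morph (fun f : dual M => f m) (id1 := 0) (op1 := +%R))//.
by apply: eq_bigr => i _; rewrite dualZ.
Qed.

Lemma coefficient_dual_basis xi m :
  coefficient xi m = \sum_i coefficient xi (db_elt (d := B) i) <* db_form i m.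
Proof.
have cl := coefficient_rlinear xi.
rewrite {1}(db_eq B m) (rlinear_sum cl).
by apply: eq_bigr => i _; rewrite (rlinearZ cl).
Qed.

(** The right action of [S] on M^* is by left colinear maps. *)
Lemma dual_coact_form_comp xi s :
  dual_coact B (form_comp xi s) =
  tmap idfun (fun eta => form_comp eta s) (dual_coact B xi).
Proof.
have sl : linear (fun eta => form_comp eta s).
  by move=> a u v; apply: dual_ext.
rewrite /dual_coact (linear_big (tmap_linear _ _ sl))//.
under eq_bigr => i _.
  rewrite -/(coefficient _ _) coefficient_form_comp coefficient_dual_basis.
  rewrite tpure_suml; under eq_bigr do rewrite tpure_bal.
  over.
rewrite exchange_big; apply: eq_bigr => j _ /=.
by rewrite tmap_pure// [form_comp (db_form j) s]dual_basis_form tpure_sumr.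
Qed.

End Coefficients.

(** * The map from [M^* ⊗_k M] to the coring *)

Section CanTilde.
Variables (k : comPzRingType) (A : pzAlgType k) (C : coring A).
Variables (M : rcomodule C) (B : dual_basis M).
Implicit Types (xi eta : dual M) (m : M).

Lemma can_mapD : {morph can_map B : x y / x + y}.
Proof. exact: tliftD (@can_tilde_balanced k A C M). Qed.

Lemma can_map_pure xi (m : M) : can_map B (dual_pure m xi) = coefficient xi m.
Proof. exact: can_tilde_pure. Qed.

Lemma dual_pure_add xi : {morph (fun m : M => dual_pure m xi) : m n / m + n}.
Proof. by move=> m n; apply: tpureDr. Qed.

Lemma dual_tensor_ind (P : dual_tensor M -> Prop) :
    (forall xi m, P (dual_pure m xi)) ->
    (forall x y, P x -> P y -> P (x + y)) ->
  forall x, P x.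
Proof. by move=> Pp PD; apply: tensor_ind => // xi m; apply: Pp. Qed.

Lemma can_map_linear : linear (can_map B).
Proof.
move=> a x y; rewrite can_mapD; congr (_ + _).
elim/dual_tensor_ind: x => [xi m|x z IHx IHz]; last first.
  by rewrite scalerDr !can_mapD scalerDr IHx IHz.
by rewrite -(linear_scale (@dual_pure_linear k A C M m)) !can_map_pure coefficientZl.
Qed.

Lemma can_map_colinear : lcolinear (can_map B).
Proof.
have cl := can_map_linear; split=> // x.
elim/dual_tensor_ind: x => [xi m|x z IHx IHz]; last first.
  rewrite can_mapD (linear_add (@lcoact_linear _ _ _ (coring_lcomod C))).
  rewrite (linear_add (@lcoact_linear _ _ _ (dual_tensor_lcomod B))).
  by rewrite tmapD// IHx IHz.
rewrite can_map_pure /= (dual_tensor_coact_pure B) (dual_basis_ctr B).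
have pl := @dual_pure_linear k A C M m.
rewrite tmap_comp// /dual_coact.
have gl : linear (can_map B \o dual_pure m).
  by move=> a u v /=; rewrite pl cl.
rewrite (linear_big (tmap_linear _ _ gl))//.
by apply: eq_bigr => i _; rewrite tmap_pure//= can_map_pure.
Qed.

End CanTilde.

(** * Slicing by functionals on the underlying vector space *)

Section Slices.
Variables (k : comPzRingType) (A : pzAlgType k) (C : coring A).
Variables (M : rcomodule C) (B : dual_basis M).
Variable psi : kspace M -> kspace M -> k.
Hypothesis psiP : left_dual_basis (idfun : kspace M -> kspace M) psi.

Definition slice (n : M) : dual_tensor M -> dual M :=
  tlift (fun xi (m : kspace M) => xi <* psi n m).

Lemma slice_balanced n :
  balanced (fun (xi : dual M) (m : kspace M) => xi <* psi n m).
Proof.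
split=> [xi eta m|xi m m'|xi l m]; first by rewrite ractDl.
  by rewrite (dual_basisD psiP) ractDr.
by rewrite ractA (dual_basisZ psiP).
Qed.

Lemma slice_pure n xi (m : M) : slice n (dual_pure m xi) = xi <* psi n m.
Proof. exact: (tlift_pure (slice_balanced n)). Qed.

Lemma sliceD n : {morph slice n : x y / x + y}.
Proof. exact: tliftD (slice_balanced n). Qed.

Lemma slice_linear n : linear (slice n).
Proof.
move=> a x y; rewrite sliceD; congr (_ + _).
elim/dual_tensor_ind: x => [xi m|x z IHx IHz]; last first.
  by rewrite scalerDr !sliceD scalerDr IHx IHz.
by rewrite -(linear_scale (@dual_pure_linear k A C M m)) !slice_pure bimodA.
Qed.

(** The coaction of [M^* ⊗_k M] only involves M^*, and [k] is central in [C]. *)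
Lemma slice_colinear n :
  @lcolinear k A C (dual_tensor_lcomod B) (dual_lcomod B) (slice n).
Proof.
have sl := slice_linear n; split=> // x.
elim/dual_tensor_ind: x => [xi m|x z IHx IHz]; last first.
  rewrite sliceD (linear_add (@lcoact_linear _ _ _ (dual_lcomod B))).
  rewrite (linear_add (@lcoact_linear _ _ _ (dual_tensor_lcomod B))).
  by rewrite tmapD// IHx IHz.
have pl := @dual_pure_linear k A C M m.
rewrite slice_pure /= (dual_tensor_coact_pure B) tmap_comp//.
rewrite dual_kactE (linear_scale (dual_coact_linear B)).
elim/tensor_ind: (dual_coact B xi) => [c eta|x z IHx IHz].
  rewrite tscale_pure tmap_pure//=; last by move=> a u v /=; rewrite pl sl.
  by rewrite slice_pure dual_kactE coring_kcentral tpure_bal.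
by rewrite scalerDr IHx IHz tmapD// => a u v /=; rewrite pl sl.
Qed.

Lemma slice_supported x : fin_supported (slice^~ x).
Proof.
elim/dual_tensor_ind: x => [xi m|x y IHx IHy].
  have [s hs] := dual_basis_supported psiP m.
  by exists s => n /hs e; rewrite slice_pure e ract0r.
rewrite (_ : slice^~ _ = fun n => slice n x + slice n y); last first.
  by apply/funext => n; rewrite sliceD.
exact: fin_supportedD.
Qed.

Lemma dual_pure_supported (F : M -> dual M) :
  fin_supported F -> fin_supported (fun n => dual_pure n (F n)).
Proof. by case=> s hs; exists s => n /hs ->; apply: tpure0l. Qed.

Lemma slice_sum x : x = \sum_(n \in [set: M]) dual_pure n (slice n x).
Proof.
elim/dual_tensor_ind: x => [xi m|x y IHx IHy].
  rewrite -{1}(dual_basis_sum psiP m).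
  rewrite (fsum_morph (dual_pure_add xi)); last first.
    exact: (dual_basis_supportedZ psiP (X := kspace M) idfun m).
  by apply: eq_fsbigr => n _; rewrite slice_pure; apply/esym/tpure_bal.
rewrite {1}IHx {1}IHy -fsumD; last 2 first.
- exact/dual_pure_supported/slice_supported.
- exact/dual_pure_supported/slice_supported.
by apply: eq_fsbigr => n _; rewrite sliceD; apply/esym/tpureDl.
Qed.

End Slices.

(** * Endomorphisms from left colinear maps to the dual *)

Section CotensorEndomorphism.
Variables (k : comPzRingType) (A : pzAlgType k) (C : coring A).
Variables (M : rcomodule C) (B : dual_basis M) (tau : C -> dual M).
Hypothesis tauP : @lcolinear k A C (coring_lcomod C) (dual_lcomod B) tau.

Let tau_linear : linear tau. Proof. exact: tauP.1. Qed.

(** The module [X] is arbitrary because the colinearity of [cotensor_endo] needs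
    the contraction for [M], for [C] and for [M ⊗ C]. *)
Definition contract (X : rmodType A) (u : M) : tensor X C -> X :=
  tlift (fun v c => v <* tau c u).

Lemma contract_balanced (X : rmodType A) u :
  balanced (fun (v : X) c => v <* tau c u).
Proof.
split=> [v w c|v c d|v a c]; first by rewrite ractDl.
  by rewrite (linear_add tau_linear) ractDr.
by rewrite ractA (linear_scale tau_linear).
Qed.

Lemma contract_pure (X : rmodType A) u (v : X) c :
  contract u (v ⊗ c) = v <* tau c u.
Proof. exact: (tlift_pure (contract_balanced X u)). Qed.

Lemma contractD (X : rmodType A) u : {morph @contract X u : x y / x + y}.
Proof. exact: tliftD (contract_balanced X u). Qed.

Lemma contract_tmap (X Y : rmodType A) (f : X -> Y) u x :
  rlinear f -> contract u (tmap f idfun x) = f (contract u x).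
Proof.
move=> fl; elim/tensor_ind: x => [v c|x y IHx IHy].
  by rewrite tmap_pure// !contract_pure (rlinearZ fl).
by rewrite tmapD// !contractD (rlinearD fl) IHx IHy.
Qed.

Lemma contract_rlinear (X : rmodType A) (x : tensor X C) :
  rlinear (fun u => contract u x).
Proof.
move=> a u w; elim/tensor_ind: x => [v c|x y IHx IHy].
  by rewrite !contract_pure dualP ractDr ractA.
by rewrite !contractD IHx IHy ractDl addrACA.
Qed.

Lemma contract_linear (X : bimodType A A) u : linear (@contract X u).
Proof.
move=> a x y; rewrite contractD; congr (_ + _).
elim/tensor_ind: x => [v c|x z IHx IHz].
  by rewrite tscale_pure !contract_pure bimodA.
by rewrite scalerDr !contractD scalerDr IHx IHz.
Qed.

(** Left colinearity of [tau], [\sum c_(1) ⊗ tau(c_(2)) = \sum_i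
    c(tau(c), e_i) ⊗ xi_i], evaluated at [u] in the second factor; the dual basis
    then reassembles [u]. *)
Lemma contract_cdelta u c : contract u (cdelta c) = coefficient (tau c) u.
Proof.
have eb : balanced (fun (d : C) (eta : dual M) => d <* eta u).
  split=> [d d' eta|d eta zeta|d a eta]; first by rewrite ractDl.
    by rewrite -ractDr.
  by rewrite ractA.
have -> : contract u (cdelta c) =
    tlift (fun (d : C) (eta : dual M) => d <* eta u) (tmap idfun tau (cdelta c)).
  elim/tensor_ind: (cdelta c) => [d e|x y IHx IHy].
    by rewrite contract_pure tmap_pure// (tlift_pure eb).
  by rewrite contractD tmapD// (tliftD eb) IHx IHy.
rewrite -[tmap _ _ _](tauP.2 c) /= /dual_coact (tlift_sum eb).
rewrite (coefficient_dual_basis B).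
by apply: eq_bigr => i _; rewrite (tlift_pure eb).
Qed.

(** By right A-linearity and coassociativity, the coaction sends
    [m_(0) tau(m_(1))(u)] to [m_(0) ⊗ m_(1) tau(m_(2))(u)]. By [contract_cdelta]
    this is [m_(0) ⊗ c(tau(m_(1)), u)], which is
    [m_(0) tau(m_(1))(u_(0)) ⊗ u_(1)]. *)
Fact cotensor_endo_subproof m :
  (fun u => contract u (rcoact m)) \in @cohom_pred k A C M M.
Proof.
have cl := contract_rlinear (rcoact m); apply/asboolP; split=> // u.
have rl := @rcoact_rlinear k A C M; have dl := @cdelta_linear k A C.
rewrite -contract_tmap//.
have assoc (w : M) (y : tensor (tensor M C) C) :
    contract w y = tmap idfun (@contract C w) (tassoc y).
  have wl := @contract_linear C w.
  elim/tensor_ind: y => [y c|x y IHx IHy]; last first.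
    by rewrite contractD tassocD tmapD// IHx IHy.
  elim/tensor_ind: y => [v d|x y IHx IHy]; last first.
    by rewrite tpureDl contractD tassocD tmapD// IHx IHy.
  by rewrite contract_pure tassoc_pure tmap_pure// contract_pure tract_pure.
rewrite assoc rcoact_coassoc tmap_comp//; last exact: contract_linear.
have tl (w : M) : linear (fun c => coefficient (tau c) w).
  by move=> a c d; rewrite tau_linear coefficientDl coefficientZl.
rewrite (@eq_tmap _ _ _ _ _ (idfun \o idfun) idfun _
  (fun c => coefficient (tau c) u))//; last first.
  by move=> c; apply: contract_cdelta.
elim/tensor_ind: (rcoact m) cl => [v c|x y IHx IHy] cl.
  rewrite tmap_pure//= /coefficient.
  elim/tensor_ind: (rcoact u) => [w d|x y IHx IHy].
    by rewrite tmap_pure// contract_pure dual_ctr_pure tpure_bal.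
  by rewrite dual_ctrD tpureDr IHx IHy tmapD.
have [xl yl] := (contract_rlinear x, contract_rlinear y).
rewrite tmapD// IHx// IHy//.
elim/tensor_ind: (rcoact u) => [w d|z t IHz IHt].
  by rewrite !tmap_pure// contractD tpureDl.
by rewrite !tmapD// -IHz -IHt addrACA.
Qed.
Definition cotensor_endo m : coend M := CoHom (cotensor_endo_subproof m).

Lemma cotensor_endoD m n : cotensor_endo (m + n) = cotensor_endo m + cotensor_endo n.
Proof.
apply: cohom_ext => u; rewrite cohomDE /=.
by rewrite (rlinearD (@rcoact_rlinear k A C M)) contractD.
Qed.

Lemma cotensor_endo_comp (s : coend M) m :
  cotensor_endo (s m) = s * cotensor_endo m.
Proof.
have [sl sP] := cohomP s; apply: cohom_ext => u /=.
by rewrite sP contract_tmap.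
Qed.

(** Left A-linearity of [tau], applied to [c(xi, m) = xi(m_(0)) m_(1)]. *)
Lemma cotensor_endo_coefficient xi m :
  tau (coefficient xi m) = form_comp xi (cotensor_endo m).
Proof.
apply: dual_ext => u; rewrite /= /coefficient.
elim/tensor_ind: (rcoact m) => [v c|x y IHx IHy].
  by rewrite dual_ctr_pure (linear_scale tau_linear) contract_pure dualZ.
by rewrite dual_ctrD (linear_add tau_linear) contractD dualD -IHx -IHy.
Qed.

End CotensorEndomorphism.

(** * The Galois map *)

Lemma lcolinear_comp (k : comPzRingType) (A : pzAlgType k) (C : coring A)
    (L M N : lcomodule C) (f : M -> N) (g : L -> M) :
  lcolinear f -> lcolinear g -> lcolinear (f \o g).
Proof.
move=> [fl fP] [gl gP]; split=> [a u v|m] /=; first by rewrite gl fl.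
by rewrite fP gP tmap_comp.
Qed.

Lemma rcolinear_bij_iso (k : comPzRingType) (A : pzAlgType k) (C : coring A)
    (M N : rcomodule C) (f : M -> N) (g : N -> M) :
  rcolinear f -> cancel f g -> cancel g f -> rcomod_iso f.
Proof.
move=> [fl fP] fK gK; split=> //; exists g; split=> //.
have gl : rlinear g by move=> a u v; apply: (can_inj fK); rewrite fl !gK.
split=> // n; rewrite -{2}(gK n) fP tmap_comp//.
rewrite -[LHS]tmap_id; apply: eq_tmap => // m /=; exact/esym/fK.
Qed.

Section GaloisMap.
Variables (k : comPzRingType) (A : pzAlgType k) (C : coring A).
Variables M N : rcomodule C.

Lemma hom_evalD : {morph @hom_eval k A C M N : x y / x + y}.
Proof. exact: tliftD (hom_eval_balanced M N). Qed.

Lemma hom_tensor_ind (P : hom_tensor M N -> Prop) :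
    (forall f m, P (hom_pure f m)) ->
    (forall x y, P x -> P y -> P (x + y)) ->
  forall x, P x.
Proof. by move=> Pp PD; apply: tensor_ind => // f m; apply: Pp. Qed.

Lemma hom_eval_rlinear : rlinear (@hom_eval k A C M N).
Proof.
move=> a x y; rewrite hom_evalD; congr (_ + _).
elim/hom_tensor_ind: x => [f m|x z IHx IHz]; last first.
  by rewrite ractDl !hom_evalD ractDl IHx IHz.
rewrite -(rlinearZ (@hom_pure_rlinear k A C M N f)) !hom_eval_pure.
exact: rlinearZ (cohom_rlinear f) _ _.
Qed.

Lemma hom_eval_colinear :
  @rcolinear k A C (hom_tensor_rcomod M N) N (@hom_eval k A C M N).
Proof.
have el := hom_eval_rlinear; split=> // x.
elim/hom_tensor_ind: x => [f m|x y IHx IHy]; last first.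
  rewrite hom_evalD (rlinearD (@rcoact_rlinear k A C N)).
  rewrite (rlinearD (@rcoact_rlinear k A C (hom_tensor_rcomod M N))).
  by rewrite tmapD// IHx IHy.
have [fl fP] := cohomP f; have hl := @hom_pure_rlinear k A C M N f.
rewrite hom_eval_pure /= hom_tensor_coact_pure tmap_comp// fP.
by apply: eq_tmap => // u /=; rewrite hom_eval_pure.
Qed.

End GaloisMap.

Section CanGalois.
Variables (k : comPzRingType) (A : pzAlgType k) (C : coring A).
Variables (M : rcomodule C) (B : dual_basis M).

(** The scalars of [k] act by elements of [S], which is why the tensor product
    over [S] is a quotient of the one over [k]. *)
Fact central_act_subproof (l : k) :
  (fun m : M => m <* (kscal l : A)) \in @cohom_pred k A C M M.
Proof.
have ll : rlinear (fun m : M => m <* (kscal l : A)).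
  by move=> a u v; rewrite ractDl !ractA kscalC.
apply/asboolP; split=> // m; rewrite (rlinearZ (@rcoact_rlinear k A C M)).
elim/tensor_ind: (rcoact m) => [v c|x y IHx IHy].
  by rewrite tract_pure tmap_pure// -coring_kcentral tpure_bal.
by rewrite ractDl tmapD// IHx IHy.
Qed.
Definition central_act l : coend M := CoHom (central_act_subproof l).

(** The projection of [M^* ⊗_k M] onto [M^* ⊗_S M], with M^* viewed as
    Hom^{-C}(M, C). *)
Definition to_hom_tensor : dual_tensor M -> hom_tensor M (coring_rcomod C) :=
  tlift (fun xi (m : kspace M) => hom_pure (coefficient_hom xi) (m : M)).

Lemma to_hom_tensor_balanced :
  balanced (fun (xi : dual M) (m : kspace M) =>
    hom_pure (coefficient_hom xi) (m : M)).
Proof.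
split=> [xi eta m|xi m n|xi l m].
- rewrite /hom_pure -tpureDl; congr (_ ⊗ _); apply: cohom_ext => u.
  exact: coefficientDl.
- exact: tpureDr.
- have -> : coefficient_hom (xi <* l) = coefficient_hom xi <* central_act l.
    rewrite -coefficient_hom_comp; congr coefficient_hom.
    by apply: dual_ext => u /=; rewrite dualZ kscalC.
  exact: tpure_bal.
Qed.

Lemma to_hom_tensor_pure xi m :
  to_hom_tensor (dual_pure m xi) = hom_pure (coefficient_hom xi) m.
Proof. exact: (tlift_pure to_hom_tensor_balanced). Qed.

Lemma to_hom_tensorD : {morph to_hom_tensor : x y / x + y}.
Proof. exact: tliftD to_hom_tensor_balanced. Qed.

Lemma galois_map_to_hom_tensor x : galois_map M (to_hom_tensor x) = can_map B x.
Proof.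
elim/dual_tensor_ind: x => [xi m|x y IHx IHy].
  by rewrite to_hom_tensor_pure can_map_pure; apply: hom_eval_pure.
by rewrite to_hom_tensorD can_mapD -IHx -IHy; apply: hom_evalD.
Qed.

End CanGalois.

(** * From a colinear splitting to a principal comodule *)

Section SplittingPrincipal.
Variables (k : comPzRingType) (A : pzAlgType k) (C : coring A).
Variables (M : rcomodule C) (B : dual_basis M).
Variable psi : kspace M -> kspace M -> k.
Hypothesis psiP : left_dual_basis (idfun : kspace M -> kspace M) psi.
Variable sigma : coring_lcomod C -> dual_tensor_lcomod B.
Hypothesis sigmaP : lcolinear sigma.
Hypothesis sigmaK : cancel sigma (can_map B).

Let tau (n : M) (c : C) : dual M := slice psi n (sigma c).

Let tauP n : @lcolinear k A C (coring_lcomod C) (dual_lcomod B) (tau n).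
Proof. exact: lcolinear_comp (slice_colinear B psiP n) sigmaP. Qed.

Let tau_supported c : fin_supported (tau^~ c).
Proof. exact: slice_supported. Qed.

Let tau_sum c : sigma c = \sum_(n \in [set: M]) dual_pure n (tau n c).
Proof. exact: slice_sum. Qed.

(** The counit applied to [c = can(sigma(c))], since the counit of [c(xi, m)] is
    [xi(m)]. *)
Lemma ceps_section_sum c : ceps c = \sum_(n \in [set: M]) tau n c n.
Proof.
rewrite -{1}(sigmaK c) tau_sum.
rewrite (fsum_morph (@can_mapD k A C M B)); last exact: dual_pure_supported.
rewrite (fsum_morph (@ceps_additive k A C)); last first.
  have [s hs] := tau_supported c; exists s => n /hs ->.
  by rewrite /dual_pure tpure0l (linear_zero (@can_map_linear k A C M B)).
by apply: eq_fsbigr => n _; rewrite can_map_pure; apply: ceps_dual_ctr.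
Qed.

Definition section_functional (n m : endmod M) : coend M :=
  cotensor_endo (tauP n) m.

Lemma contract_section_supported x :
  exists s : seq M, forall n, n \notin s -> forall u, contract (tau n) u x = 0 :> M.
Proof.
elim/tensor_ind: x => [v c|x y [s hs] [t ht]].
  have [s hs] := tau_supported c; exists s => n /hs e u.
  by rewrite (contract_pure (tauP n)) e ract0r.
exists (s ++ t) => n; rewrite mem_cat negb_or => /andP[/hs hx /ht hy] u.
by rewrite (contractD (tauP n)) hx hy addr0.
Qed.

Lemma contract_section_sum x :
  \sum_(n \in [set: M]) contract (tau n) n x = tlift (fun v c => v <* ceps c) x :> M.
Proof.
have cb := rcounit_balanced C M.
elim/tensor_ind: x => [v c|x y IHx IHy].
  rewrite (tlift_pure cb) ceps_section_sum (fsum_morph (ractDr v)).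
    by apply: eq_fsbigr => n _; rewrite (contract_pure (tauP n)).
  by have [s hs] := tau_supported c; exists s => n /hs ->.
rewrite (tliftD cb) -IHx -IHy -fsumD.
- by apply: eq_fsbigr => n _; rewrite (contractD (tauP n)).
- by have [s hs] := contract_section_supported x; exists s => n /hs.
- by have [s hs] := contract_section_supported y; exists s => n /hs.
Qed.

(** The endomorphisms attached to [m] recover it because
    [\sum_n m_(0) tau_n(m_(1))(n) = \sum m_(0) eps(m_(1)) = m]. *)
Lemma section_dual_basis :
  left_dual_basis (idfun : endmod M -> endmod M) section_functional.
Proof.
split=> [n s u v|m|m].
- by rewrite /section_functional cotensor_endoD cotensor_endo_comp.
- have [s hs] := contract_section_supported (rcoact (m : M)).
  by exists s => n /hs e; apply: cohom_ext => u; apply: e.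
- rewrite -[LHS](rcoact_counit (m : M)) -contract_section_sum.
  exact: eq_fsbigr.
Qed.

(** On [c(xi, -) ⊗_S m] the composite is
    [\sum_n c(xi \o phi_n(m), -) ⊗_S n = \sum_n c(xi, -) ⊗_S phi_n(m)(n)], where
    [phi] is the dual basis of [section_dual_basis]. *)
Lemma galois_mapK : cancel (galois_map M) (fun c => to_hom_tensor (sigma c)).
Proof.
have sD : {morph sigma : x y / x + y} by apply/linear_add/sigmaP.1.
elim/hom_tensor_ind => [f m|x y IHx IHy]; last first.
  by rewrite /galois_map hom_evalD sD to_hom_tensorD IHx IHy.
rewrite -(coefficient_hom_counit_form f); set xi := counit_form f.
rewrite [galois_map _ _]hom_eval_pure tau_sum.
rewrite (fsum_morph (@to_hom_tensorD k A C M)); last exact: dual_pure_supported.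
rewrite -[in RHS](dual_basis_sum section_dual_basis m).
have hD : {morph (hom_pure (coefficient_hom xi) : endmod M -> _) : u v / u + v}.
  exact: tpureDr.
rewrite (fsum_morph hD); last first.
  exact: (dual_basis_supportedZ section_dual_basis (X := endmod M) idfun m).
apply: eq_fsbigr => n _.
rewrite to_hom_tensor_pure [tau n _](cotensor_endo_coefficient (tauP n)).
rewrite coefficient_hom_comp; exact: tpure_bal.
Qed.

Lemma split_epi_principal :
  fin_gen_right M -> projective_right M -> principal_rcomod M.
Proof.
move=> Mfg Mproj; split; last exact: dual_basis_projective section_dual_basis.
split=> //; apply: (rcolinear_bij_iso (hom_eval_colinear M _) galois_mapK) => c.
by rewrite [hom_eval _](galois_map_to_hom_tensor B) sigmaK.
Qed.

End SplittingPrincipal.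

(** * From a principal comodule to a colinear splitting *)

Section PrincipalSplitting.
Variables (k : comPzRingType) (A : pzAlgType k) (C : coring A).
Variables (M : rcomodule C) (B : dual_basis M).
Variable phi : endmod M -> endmod M -> coend M.
Hypothesis phiP : left_dual_basis (idfun : endmod M -> endmod M) phi.
Variable g : C -> hom_tensor M (coring_rcomod C).
Hypothesis gD : {morph g : c d / c + d}.
Hypotheses (galK : cancel (galois_map M) g) (gK : cancel g (galois_map M)).

(** The Galois map is surjective, and colinear maps from [M] to [C] are given by
    forms. *)
Lemma coefficient_ind (P : C -> Prop) :
    (forall (xi : dual M) (m : M), P (coefficient xi m)) ->
    (forall c d, P c -> P d -> P (c + d)) ->
  forall c, P c.
Proof.
move=> Pp PD c; rewrite -[c]gK; elim/hom_tensor_ind: (g c) => [f m|x y Px Py].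
  by rewrite [galois_map _ _]hom_eval_pure -coefficient_counit_form.
by rewrite [galois_map _ _]hom_evalD; apply: PD.
Qed.

Let term xi m n : dual_tensor M := dual_pure n (form_comp xi (phi n m)).

Let term_supported xi m : fin_supported (term xi m).
Proof.
apply: dual_pure_supported; have [s hs] := dual_basis_supported phiP m.
by exists s => n /hs ->; apply: dual_ext => u /=; apply: dual0.
Qed.

(** A section of [to_hom_tensor]; it is balanced over [S] because [phi] is
    S-linear. *)
Definition from_hom_tensor : hom_tensor M (coring_rcomod C) -> dual_tensor M :=
  tlift (fun f (m : endmod M) => \sum_(n \in [set: M]) term (counit_form f) m n).

Lemma from_hom_tensor_balanced :
  balanced (fun (f : cohom M (coring_rcomod C)) (m : endmod M) =>
    \sum_(n \in [set: M]) term (counit_form f) m n).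
Proof.
split=> [f f' m|f m m'|f s m].
- rewrite -fsumD//; apply: eq_fsbigr => n _; rewrite /term /dual_pure -tpureDl.
  by congr (_ ⊗ _); apply: dual_ext => u /=; apply: ceps_additive.
- rewrite -fsumD//; apply: eq_fsbigr => n _; rewrite /term /dual_pure -tpureDl.
  congr (_ ⊗ _); apply: dual_ext => u.
  rewrite dualDE /= -ceps_additive -(rlinearD (cohom_rlinear f)).
  by rewrite (dual_basisD phiP).
- apply: eq_fsbigr => n _; congr (dual_pure _ _); apply: dual_ext => u /=.
  by rewrite (dual_basisZ phiP).
Qed.

Lemma from_hom_tensor_pure f m :
  from_hom_tensor (hom_pure f m) = \sum_(n \in [set: M]) term (counit_form f) m n.
Proof. exact: (tlift_pure from_hom_tensor_balanced). Qed.

Lemma from_hom_tensorD : {morph from_hom_tensor : x y / x + y}.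
Proof. exact: tliftD from_hom_tensor_balanced. Qed.

Definition can_section (c : C) : dual_tensor M := from_hom_tensor (g c).

Lemma can_sectionD : {morph can_section : c d / c + d}.
Proof. by move=> c d; rewrite /can_section gD from_hom_tensorD. Qed.

Lemma can_section_coefficient xi m :
  can_section (coefficient xi m) = \sum_(n \in [set: M]) term xi m n.
Proof.
have -> : coefficient xi m = galois_map M (hom_pure (coefficient_hom xi) m).
  by rewrite [galois_map _ _]hom_eval_pure.
by rewrite /can_section galK from_hom_tensor_pure counit_form_coefficient_hom.
Qed.

Lemma can_section_linear : linear can_section.
Proof.
move=> a c d; rewrite can_sectionD; congr (_ + _).
elim/coefficient_ind: c => [xi m|c c' IH IH']; last first.
  by rewrite scalerDr !can_sectionD scalerDr IH IH'.
rewrite -coefficientZl !can_section_coefficient.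
rewrite (fsum_morph (scalerDr a))//; apply: eq_fsbigr => n _.
rewrite -(linear_scale (@dual_pure_linear k A C M n)).
by congr dual_pure; apply: dual_ext.
Qed.

Lemma can_sectionK : cancel can_section (can_map B).
Proof.
move=> c; elim/coefficient_ind: c => [xi m|c d IHc IHd]; last first.
  by rewrite can_sectionD can_mapD IHc IHd.
rewrite can_section_coefficient (fsum_morph (@can_mapD k A C M B))//.
have cD : {morph (coefficient xi : endmod M -> C) : u v / u + v}.
  exact: coefficientDr.
rewrite -[in RHS](dual_basis_sum phiP m) (fsum_morph cD); last first.
  exact: (dual_basis_supportedZ phiP (X := endmod M) idfun m).
apply: eq_fsbigr => n _.
by rewrite /term can_map_pure coefficient_form_comp.
Qed.

(** On [c(xi, m)] both sides are
    [\sum_i \sum_n c(xi, e_i) ⊗ (xi_i \o phi_n(m)) ⊗ n], as [S] acts on M^* by colinear maps. *)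
Lemma can_section_colinear :
  @lcolinear k A C (coring_lcomod C) (dual_tensor_lcomod B) can_section.
Proof.
have sl := can_section_linear; split=> // c.
have tl := @lcoact_linear k A C (dual_tensor_lcomod B).
elim/coefficient_ind: c => [xi m|c d IHc IHd]; last first.
  rewrite can_sectionD (linear_add tl) IHc IHd.
  by rewrite (linear_add (@lcoact_linear k A C (coring_lcomod C))) tmapD.
rewrite can_section_coefficient /= (dual_basis_ctr B) -/coefficient.
rewrite (linear_big (tmap_linear _ _ sl))// (fsum_morph (dual_tensor_coactD B))//.
have [s [us hs]] := fin_supported_uniq (dual_basis_supported phiP m).
have term0 eta n : n \notin s -> term eta m n = 0.
  move=> /hs e; rewrite /term e -[RHS](tpure0l (dual M) (n : kspace M)).
  by congr (_ ⊗ _); apply: dual_ext => u /=; apply: dual0.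
rewrite (fsumE us); last by move=> n /term0 ->; apply: (linear_zero tl).
under [RHS]eq_bigr => i _.
  rewrite tmap_pure// [can_section _]can_section_coefficient.
  rewrite (fsumE us); last by move=> n; apply: term0.
  rewrite tpure_sumr; over.
rewrite exchange_big; apply: eq_bigr => n _ /=.
have pl := @dual_pure_linear k A C M n.
have fl : linear (fun eta => form_comp eta (phi n m)).
  by move=> a u v; apply: dual_ext.
have pfl : linear (dual_pure n \o (fun eta => form_comp eta (phi n m))).
  by move=> a u v /=; rewrite fl pl.
rewrite /term (dual_tensor_coact_pure B) dual_coact_form_comp tmap_comp//.
rewrite /dual_coact (linear_big (tmap_linear _ _ pfl))//.
by apply: eq_bigr => i _; rewrite tmap_pure.
Qed.

End PrincipalSplitting.

(** The functionals [c |-> tau_n(c)(e_i)], for [tau_n] the slices of [sigma],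
    form with the elements [c(xi_i, n)] a dual basis of the left A-module [C]. *)
Lemma linear_section_flat (k : comPzRingType) (A : pzAlgType k) (C : coring A)
    (M : rcomodule C) (B : dual_basis M) (psi : kspace M -> kspace M -> k)
    (sigma : C -> dual_tensor M) :
    left_dual_basis (idfun : kspace M -> kspace M) psi ->
    linear sigma -> cancel sigma (can_map B) ->
  flat_left C.
Proof.
move=> psiP sl sK.
pose b (p : 'I_(db_size B) * M) : C := coefficient (db_form p.1) p.2.
pose phi (p : 'I_(db_size B) * M) (c : C) : A :=
  slice psi p.2 (sigma c) (db_elt p.1).
apply: (@dual_basis_flat _ _ _ b phi).
have supp c := slice_supported psiP (sigma c).
split=> [[i n] a c d|c|c].
- by rewrite /phi /= sl (slice_linear psiP).
- have [s hs] := supp c.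
  exists (allpairs pair (enum 'I_(db_size B)) s) => -[i n] h.
  rewrite /phi /= hs//; apply: contra h => ns.
  by apply/allpairsP; exists (i, n); rewrite mem_enum.
- have [s [us hs]] := fin_supported_uniq (supp c).
  rewrite (fsumE (s := allpairs pair (enum 'I_(db_size B)) s)); last 2 first.
  + by rewrite allpairs_uniq ?enum_uniq//; case=> ? ? [? ?] _ _ [-> ->].
  + move=> [i n] h; rewrite /phi /= hs ?scale0r//; apply: contra h => ns.
    by apply/allpairsP; exists (i, n); rewrite mem_enum.
  rewrite big_allpairs exchange_big /= -{1}(sK c) (slice_sum psiP (sigma c)).
  rewrite (fsumE us); last by move=> n /hs ->; apply: tpure0l.
  rewrite (linear_big (@can_map_linear k A C M B)); apply: eq_bigr => n _.
  rewrite can_map_pure {1}(dual_basis_form B (slice psi n (sigma c))).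
  rewrite (big_morph (fun xi => coefficient xi n) (id1 := 0) (op1 := +%R)).
  + by rewrite big_enum; apply: eq_bigr => i _; rewrite coefficientZl.
  + by move=> xi eta; apply: coefficientDl.
  + by have := coefficientZl 0 0 n; rewrite !scale0r.
Qed.

(** * The equivalence *)

Theorem theorem4p4 (k : fieldType) (A : pzAlgType k) (C : coring A)
    (M : rcomodule C)
    (M_fg : fin_gen_right M) (M_proj : projective_right M)
    (B : dual_basis M) :
  (flat_left C /\
     lcomod_split_epi (can_map B))
  <-> principal_rcomod M.
Proof.
have [psi psiP] := projective_dual_basis (field_projective (V := kspace M)).
split=> [[_ [_ [sigma [sigmaP sigmaK]]]]|[[_ _ [_ [g [[gl _] galK gK]]]] M_projS]].
  exact: split_epi_principal psiP sigma sigmaP sigmaK M_fg M_proj.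
have [phi phiP] := projective_dual_basis M_projS.
have gD := rlinearD gl.
have sP := can_section_colinear B phiP gD galK gK.
have sK := can_sectionK B phiP gD galK gK.
split; first exact: linear_section_flat psiP sP.1 sK.
by split; [exact: can_map_colinear|exists (can_section phi g)].
Qed.
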